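(* There is a constant $C$ such that for all $N\ge1$ and all $f\in L^2(\mathbb{R}\times\mathbb{T})$, $$\|e^{it\partial_x\partial_y}P_{\le N}f\|_{L^4_{t,x,y}([0,1]\times\mathbb{R}\times\mathbb{T})}\le C\Big((\log N)^{\frac14}\|f\|_{L^2(\mathbb{R}\times\mathbb{T})}+N^{\frac14}\|\widehat f(\xi,n)\|_{\ell^4_nL^2_\xi}\Big),$$ where $\|\widehat f(\xi,n)\|_{\ell^4_nL^2_\xi}=\big(\sum_{n\in\mathbb{Z}}\big(\int_{\mathbb{R}}|\widehat f(\xi,n)|^2d\xi\big)^{2}\big)^{1/4}$.
   Context: $\mathbb{T}=\mathbb{R}/\mathbb{Z}$. Fourier transform $\widehat f(\xi,n)=\int_{\mathbb{R}\times\mathbb{T}}e^{-2\pi i(\xi x+ny)}f(x,y)\,dx\,dy$, $(\xi,n)\in\mathbb{R}\times\mathbb{Z}$. $e^{it\partial_x\partial_y}$ is the propagator of $i\partial_tu+\partial_x\partial_yu=0$, i.e. the Fourier multiplier $e^{-4\pi^2 it\xi n}$. $\varphi$ is a fixed smooth radial function on $\mathbb{R}$ equal to $1$ on $|x|\le1$ and $0$ on $|x|\ge2$, and $P_{\le N}$ is the Fourier multiplier $\varphi(\xi/N)\varphi(n/N)$. *)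

(* Defs.v *)
From HB Require Import structures.
From mathcomp Require Import all_boot all_order all_algebra.
From mathcomp Require Import all_classical all_reals all_analysis.
From mathcomp Require Import complex.

Set Implicit Arguments.
Unset Strict Implicit.
Unset Printing Implicit Defensive.

Import Order.TTheory GRing.Theory Num.Theory.
Import numFieldNormedType.Exports.

Local Open Scope classical_set_scope.
Local Open Scope ring_scope.

Section Defs.
Variable R : realType.

Local Notation mu := (@lebesgue_measure R).

Definition expi (th : R) : R[i] := Complex (cos th) (sin th).

Definition cabs (z : R[i]) : R := Num.sqrt (complex.Re z ^+ 2 + complex.Im z ^+ 2).

Definition cintegral (D : set R) (g : R -> R[i]) : R[i] :=
  Complex (Rintegral mu D (fun x => complex.Re (g x)))
          (Rintegral mu D (fun x => complex.Im (g x))).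

Definition csumZ (a : int -> R[i]) : R[i] :=
  Complex
    (lim ((fun K : nat => \sum_(k < (2 * K).+1) complex.Re (a (k%:Z - K%:Z))) @ \oo))
    (lim ((fun K : nat => \sum_(k < (2 * K).+1) complex.Im (a (k%:Z - K%:Z))) @ \oo)).

(* The torus T = R/Z is represented by the fundamental domain [0,1[ :
   functions on R x T are functions f : R -> R -> R[i] (1-periodic in y). *)
Definition torus_dom : set R := `[0%R, 1%R[%classic.

Definition L2sq_RT (f : R -> R -> R[i]) : \bar R :=
  (\int[mu]_(x in setT) \int[mu]_(y in torus_dom) ((cabs (f x y)) ^+ 2)%:E)%E.

Definition L2sq_RZ (g : R -> int -> R[i]) : \bar R :=
  (\esum_(n in setT) \int[mu]_(xi in setT) ((cabs (g xi n)) ^+ 2)%:E)%E.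

Definition l4L2_RZ (g : R -> int -> R[i]) : \bar R :=
  poweR (\esum_(n in setT)
           ((\int[mu]_(xi in setT) ((cabs (g xi n)) ^+ 2)%:E) *
            (\int[mu]_(xi in setT) ((cabs (g xi n)) ^+ 2)%:E)))%E
        (4%:R)^-1.

Definition fourier_trunc (K : nat) (f : R -> R -> R[i]) (xi : R) (n : int)
    : R[i] :=
  cintegral `[- (K%:R), K%:R]%classic (fun x =>
    cintegral torus_dom (fun y =>
      expi (- (2 * pi * (xi * x + n%:~R * y))) * f x y)).

(* fhat is the (Plancherel, L^2) Fourier transform of f in L^2(R x T):
   the L^2(R x Z) limit of the truncated Fourier integrals. *)
Definition is_fourier_L2 (f : R -> R -> R[i]) (fhat : R -> int -> R[i]) :=
  ((fun K : nat => L2sq_RZ (fun xi n => fourier_trunc K f xi n - fhat xi n))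
     @ \oo --> 0%E).

(* u(t,x,y) = (e^{it d_x d_y} P_{<=N} f)(x,y): the function whose Fourier
   transform is e^{-4 pi^2 i t xi n} phi(xi/N) phi(n/N) fhat(xi,n)
   (Fourier inversion of this integrable, compactly supported function). *)
Definition schrod_PN (phi : R -> R) (N : R) (fhat : R -> int -> R[i])
    (t x y : R) : R[i] :=
  csumZ (fun n => cintegral setT (fun xi =>
    expi (2 * pi * (xi * x + n%:~R * y)) *
    expi (- (4 * pi ^+ 2 * t * xi * n%:~R)) *
    ((phi (xi / N) * phi (n%:~R / N))%:C)%C * fhat xi n)).

Definition L4_time_RT (u : R -> R -> R -> R[i]) : \bar R :=
  poweR (\int[mu]_(t in `[0%R, 1%R]%classic)
           \int[mu]_(x in setT) \int[mu]_(y in torus_dom)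
              ((cabs (u t x y)) ^+ 4)%:E)%E
        (4%:R)^-1.

Definition smooth_fun (phi : R -> R) :=
  forall (k : nat) (x : R), derivable (derive1n k phi) x 1.

End Defs.

(* Main.v *)
Require Import Defs.
From HB Require Import structures.
From mathcomp Require Import all_boot all_order all_algebra.
From mathcomp Require Import all_classical all_reals all_analysis.
From mathcomp Require Import complex.
From mathcomp Require Import measurable_realfun ring lra zify.

(** The solution is [u = sum_n e(n y) g_n (x - 2 pi n t)], a sum of waves
    travelling with distinct speeds, where [g_n] is the inverse Fourier transform
    of the n-th symbol. By Parseval in [y], the integral of [|u|^4 = |u^2|^2] is
    the sum over [s] of [|sum_(n + m = s) h_n h_m|^2], with
    [h_n = g_n (x - 2 pi n t)]. Cauchy-Schwarz with the weights [|n - m|] bounds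
    the off-diagonal part by [log N] times the sum of the
    [|n - m| |h_n|^2 |h_m|^2]; in the coordinates [x - 2 pi n t] and
    [x - 2 pi m t] the integral of each of these over (t, x) is
    [||g_n||_2^2 ||g_m||_2^2 / (2 pi)], which yields the term [log N ||f||_2^4].
    On the diagonal [||g_n||_4^4 <= ||g_n||_oo^2 ||g_n||_2^2], which is [O(N)]
    times the fourth power of the L^2 norm of the n-th coefficient. *)

Import Order.TTheory GRing.Theory Num.Theory.
Import numFieldNormedType.Exports.

Local Open Scope classical_set_scope.
Local Open Scope ring_scope.

Set Implicit Arguments.
Unset Strict Implicit.
Unset Printing Implicit Defensive.

(** Both Fourier transforms enter only through upper bounds for L^2 norms, and each of these comes
    from Bessel's inequality for finitely many orthogonal characters: on the torus for the variable
    y, on an interval [[-K, K]] for the line. As [fhat] is known only as an L^2 limit of truncated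
    transforms, its norm is compared with that of f up to a factor 2, which goes into C. The
    restriction of t to [0, 1] matters on the diagonal alone. Waves of distinct speeds separate, so
    their products are integrable over all times, and the speed gap [2 pi |n - m|] pays for the
    weight [|n - m|]. The integral over x of [|h_n|^4] does not depend on t, so nothing is gained
    there; the weight on the diagonal must then be small enough to cancel the logarithm produced by
    Cauchy-Schwarz. The last obstacle is that [ln N] vanishes at N = 1. There are then boundedly
    many frequencies, and the l^4 term has to absorb the square of the L^2 mass as well. *)

(** * Monotonicity, affine change of variables, integrals with a parameter *)

Section integral_complements.
Variable R : realType.
Local Notation mu := (@lebesgue_measure R).

Import HBNNSimple.

(** A nonnegative integral is a supremum over the simple functions lying below the integrand, so
    monotonicity needs no measurability. This allows iterated integrals of [|u|^4] to be bounded
    without proving the inner ones measurable. *)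
Lemma le_integral_ge0 (d : measure_display) (T : measurableType d)
    (m : {measure set T -> \bar R}) (D : set T) (f g : T -> \bar R) :
  (forall x, D x -> 0 <= f x)%E -> (forall x, D x -> f x <= g x)%E ->
  (\int[m]_(x in D) f x <= \int[m]_(x in D) g x)%E.
Proof.
move=> f0 fg; rewrite integral_mkcond [leRHS]integral_mkcond.
have F0 x : (0 <= (f \_ D) x)%E by apply: erestrict_ge0.
have FG x : ((f \_ D) x <= (g \_ D) x)%E by apply: lee_restrict.
rewrite !ge0_integralTE//; last by move=> x; apply: le_trans (FG x).
apply: ge_ereal_sup => _ [h hf <-]; apply: ereal_sup_ubound.
by exists h => // x; apply: le_trans (FG x).
Qed.

Lemma preimage_affine_gt0 (a b p q : R) : 0 < a ->
  (fun x => a * x + b) @^-1` `]p, q]%classic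
  = `](p - b) / a, (q - b) / a]%classic.
Proof.
move=> a0; apply/seteqP; split => x /=; rewrite !in_itv/=;
by rewrite ltr_pdivrMr// ler_pdivlMr// ltrBlDr lerBrDr mulrC.
Qed.

Lemma preimage_affine_lt0 (a b p q : R) : a < 0 ->
  (fun x => a * x + b) @^-1` `]p, q]%classic
  = `[(q - b) / a, (p - b) / a[%classic.
Proof.
move=> a0; apply/seteqP; split => x /=; rewrite !in_itv/=;
by rewrite ltr_ndivlMr// ler_ndivrMr// ltrBlDr lerBrDr mulrC andbC.
Qed.

Definition affine (a b : R) (x : measurableTypeR R) : measurableTypeR R :=
  a * x + b.

Lemma measurable_affine (a b : R) : measurable_fun setT (affine a b).
Proof. by apply: measurable_funD => //; apply: measurable_funM. Qed.

(** By uniqueness of Lebesgue measure it suffices to compare both sides on intervals []p, q]]. A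
    negative slope moves the closed end to the left, hence the two preimage lemmas. *)
Lemma lebesgue_measure_affine (a b : R) (A : set R) : a != 0 -> measurable A ->
  mu A = (`|a|%:E * pushforward mu (affine a b) A)%E.
Proof.
move=> a0 mA.
pose P0 : {measure set (measurableTypeR R) -> \bar R} :=
  mscale (NngNum (normr_ge0 a)) (pushforward mu (affine a b)).
pose P := P0 (measurable_affine a b).
rewrite [RHS](_ : _ = P A)//.
apply: lebesgue_measure_unique => // _ [[p q] _ <-].
rewrite /P/P0/= /mscale/= /pushforward/=.
have : (a < 0) || (0 < a) by rewrite -neq_lt.
move=> /orP[a_|a_].
  rewrite preimage_affine_lt0// !lebesgue_measure_itv/= !lte_fin.
  rewrite ltr_ndivrMr// divfK// ltrBlDr subrK.
  case: ifPn => [pq|]; last by rewrite mule0.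
  rewrite -!EFinB -EFinM ltr0_norm//; congr EFin.
  by field.
rewrite preimage_affine_gt0// !lebesgue_measure_itv/= !lte_fin.
rewrite ltr_pdivrMr// divfK// ltrBlDr subrK.
case: ifPn => [pq|]; last by rewrite mule0.
rewrite -!EFinB -EFinM gtr0_norm//; congr EFin.
by field.
Qed.

Lemma ge0_integral_affine (a b : R) (f : R -> \bar R) : a != 0 ->
  measurable_fun setT f -> (forall x, 0 <= f x)%E ->
  (\int[mu]_x f (a * x + b)%R = (`|a|^-1)%:E * \int[mu]_x f x)%E.
Proof.
move=> a0 mf f0.
pose Q0 : {measure set (measurableTypeR R) -> \bar R} :=
  pushforward mu (affine a b).
pose Q := Q0 (measurable_affine a b).
have -> : (\int[mu]_x f x = \int[mscale (NngNum (normr_ge0 a)) Q]_x f x)%E.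
  apply: eq_measure_integral => A mA _.
  exact: lebesgue_measure_affine.
rewrite ge0_integral_mscale// muleA -EFinM/= mulVf ?normr_eq0// mul1e.
by rewrite ge0_integral_pushforward//; exact: measurable_affine.
Qed.

Lemma ge0_integral_translation (b : R) (f : R -> \bar R) :
  measurable_fun setT f -> (forall x, 0 <= f x)%E ->
  (\int[mu]_x f (x + b)%R = \int[mu]_x f x)%E.
Proof.
move=> mf f0; have := @ge0_integral_affine 1 b f (oner_neq0 _) mf f0.
by rewrite normr1 invr1 mul1e => <-; apply: eq_integral => x _; rewrite mul1r.
Qed.

(** Tonelli applies to the positive and negative parts separately, and [fine] is total: no
    integrability in y is required, divergent slices receiving a default value. *)
Lemma measurable_Rintegral_param (d : measure_display) (T : measurableType d)
    (D : set (measurableTypeR R)) (g : T * R -> R) :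
  measurable D -> measurable_fun setT g ->
  measurable_fun setT (fun x => Rintegral mu D (fun y => g (x, y))).
Proof.
move=> mD mg.
pose h : T * R -> \bar R := (fun z => (g z)%:E) \_ ([set: T] `*` D).
have mh : measurable_fun setT h.
  apply/(measurable_restrictT _ _).1; first exact: measurableX.
  by apply/measurable_EFinP; exact: measurable_funTS.
have hE x y : ((fun y => (g (x, y))%:E) \_ D) y = h (x, y).
  rewrite /h !patchE.
  have -> // : ((x, y) \in [set: T] `*` D) = (y \in D).
  by apply/idP/idP; rewrite !inE//= => -[].
rewrite [X in measurable_fun _ X](_ : _ = fine \o fun x =>
    (\int[mu]_y h^\+ (x, y) - \int[mu]_y h^\- (x, y))%E); last first.
  apply/funext => x; rewrite /Rintegral integral_mkcond integralE.
  by congr (fine (_ - _)%E); apply: eq_integral => y _;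
     rewrite ?funeposE ?funenegE hE.
apply: measurableT_comp => //; apply: emeasurable_funB.
  by apply: (@measurable_fun_fubini_tonelli_F _ _ _ _ _ mu (h^\+)%E) => //;
    exact: measurable_funepos.
by apply: (@measurable_fun_fubini_tonelli_F _ _ _ _ _ mu (h^\-)%E) => //;
    exact: measurable_funeneg.
Qed.

End integral_complements.

(** * Squared modulus, characters, weighted Cauchy-Schwarz *)

Section complex_complements.
Variable R : realType.
Implicit Types (z : R[i]) (x : R).

(** The squared modulus as a polynomial in the real and imaginary parts, without the square root of
    [cabs], so that ring identities and measurability apply directly. *)
Definition normsq z : R := complex.Re z ^+ 2 + complex.Im z ^+ 2.

Lemma normsq_ge0 z : 0 <= normsq z.
Proof. by rewrite addr_ge0 ?sqr_ge0. Qed.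

Lemma cabs_sqr z : cabs z ^+ 2 = normsq z.
Proof. by rewrite sqr_sqrtr ?normsq_ge0. Qed.

Lemma cabs_exp4 z : cabs z ^+ 4 = normsq z ^+ 2.
Proof. by rewrite -cabs_sqr -exprM. Qed.

Lemma ReM z1 z2 : complex.Re (z1 * z2) =
  complex.Re z1 * complex.Re z2 - complex.Im z1 * complex.Im z2.
Proof. by case: z1 => a b; case: z2. Qed.

Lemma ImM z1 z2 : complex.Im (z1 * z2) =
  complex.Re z1 * complex.Im z2 + complex.Im z1 * complex.Re z2.
Proof. by case: z1 => a b; case: z2. Qed.

Lemma Re_sum (I : Type) (r : seq I) (P : pred I) (F : I -> R[i]) :
  complex.Re (\sum_(i <- r | P i) F i) = \sum_(i <- r | P i) complex.Re (F i).
Proof. by apply: (big_morph (@complex.Re R)) => // -[? ?] [? ?]. Qed.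

Lemma Im_sum (I : Type) (r : seq I) (P : pred I) (F : I -> R[i]) :
  complex.Im (\sum_(i <- r | P i) F i) = \sum_(i <- r | P i) complex.Im (F i).
Proof. by apply: (big_morph (@complex.Im R)) => // -[? ?] [? ?]. Qed.

Lemma normsqM z1 z2 : normsq (z1 * z2) = normsq z1 * normsq z2.
Proof. by rewrite /normsq ReM ImM; ring. Qed.

Lemma normsq_expi x : normsq (expi x) = 1.
Proof. exact: cos2Dsin2. Qed.

Lemma normsq_real x : normsq (x%:C)%C = x ^+ 2.
Proof. by rewrite /normsq /= expr0n addr0. Qed.

Lemma normsqD_le z1 z2 : normsq (z1 + z2) <= 2 * normsq z1 + 2 * normsq z2.
Proof.
case: z1 => a b; case: z2 => c d; rewrite /normsq/=.
have := sqr_ge0 (a - c); have := sqr_ge0 (b - d); nra.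
Qed.

Lemma expiD (x y : R) : expi (x + y) = expi x * expi y.
Proof.
apply/eqP; rewrite eq_complex ReM ImM/= cosD sinD eqxx/=.
by apply/eqP; ring.
Qed.

Lemma expi0 : expi (0 : R) = 1.
Proof. by rewrite /expi cos0 sin0. Qed.

Lemma expi_2pi_int (k : int) : expi (2 * pi * k%:~R : R) = 1.
Proof.
have H (n : nat) : expi (2 * pi * n%:R : R) = 1.
  elim: n => [|n IH]; first by rewrite mulr0 expi0.
  rewrite -(natr1 n) mulrDr mulr1 expiD IH mul1r.
  by rewrite -[2 * pi]add0r mulr_natl /expi cosD2pi sinD2pi cos0 sin0.
case: k => n; first exact: H.
rewrite NegzE mulrNz mulrN.
have := expiD (2 * pi * n.+1%:R) (- (2 * pi * n.+1%:R)).
by rewrite subrr expi0 H mul1r => <-.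
Qed.

(** After doubling and symmetrizing, the claim holds pair by pair: it is
    [(w_i a_i - w_j a_j)^2 >= 0] divided by [w_i w_j]. *)
Lemma sqr_sum_le (I : Type) (r : seq I) (P : pred I) (w a : I -> R) :
  (forall i, P i -> 0 < w i) ->
  (\sum_(i <- r | P i) a i) ^+ 2 <=
  (\sum_(i <- r | P i) (w i)^-1) * (\sum_(i <- r | P i) w i * a i ^+ 2).
Proof.
move=> w0; rewrite -(ler_pM2l (ltr0Sn _ 1)).
have -> : 2 * ((\sum_(i <- r | P i) (w i)^-1) * (\sum_(i <- r | P i) w i * a i ^+ 2))
   = \sum_(i <- r | P i) \sum_(j <- r | P j)
       ((w i)^-1 * (w j * a j ^+ 2) + (w j)^-1 * (w i * a i ^+ 2)).
  under [RHS]eq_bigr do rewrite big_split/= -mulr_sumr -mulr_suml.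
  by rewrite big_split/= -mulr_suml -mulr_sumr; ring.
rewrite expr2 mulr_suml mulr_sumr; apply: ler_sum => i Pi.
rewrite mulr_sumr mulr_sumr; apply: ler_sum => j Pj.
have wi := w0 _ Pi; have wj := w0 _ Pj.
have wV : 0 < (w i)^-1 * (w j)^-1 by rewrite mulr_gt0 ?invr_gt0.
have := mulr_ge0 (ltW wV) (sqr_ge0 (w i * a i - w j * a j)).
rewrite -subr_ge0 => h; rewrite -subr_ge0.
apply: le_trans h _; rewrite subr0 le_eqVlt; apply/orP; left; apply/eqP.
by field; rewrite !gt_eqF.
Qed.

Lemma normsq_sum_le (I : Type) (r : seq I) (P : pred I) (w : I -> R)
    (z : I -> R[i]) : (forall i, P i -> 0 < w i) ->
  normsq (\sum_(i <- r | P i) z i) <=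
  (\sum_(i <- r | P i) (w i)^-1) * (\sum_(i <- r | P i) w i * normsq (z i)).
Proof.
move=> w0; rewrite /normsq Re_sum Im_sum.
under [X in _ * X]eq_bigr do rewrite mulrDr.
by rewrite big_split/= mulrDr lerD// sqr_sum_le.
Qed.

Lemma normsq_sumE (I : Type) (r : seq I) (P : pred I) (z : I -> R[i]) :
  normsq (\sum_(i <- r | P i) z i) =
  \sum_(i <- r | P i) \sum_(j <- r | P j)
    (complex.Re (z i) * complex.Re (z j) + complex.Im (z i) * complex.Im (z j)).
Proof.
rewrite /normsq Re_sum Im_sum !expr2 !mulr_suml -big_split/=.
by apply: eq_bigr => i _; rewrite !mulr_sumr -big_split.
Qed.

End complex_complements.

(** * Real integrable functions on a fixed domain *)

Section Rintegrable.
Variable R : realType.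
Local Notation mu := (@lebesgue_measure R).
Variables (D : set (measurableTypeR R)) (mD : measurable D).

Definition Rintegrable (f : R -> R) := mu.-integrable D (EFin \o f).

Lemma eq_Rintegrable (f g : R -> R) : f =1 g -> Rintegrable f -> Rintegrable g.
Proof. by move=> /funext ->. Qed.

Lemma RintegrableD (f g : R -> R) : Rintegrable f -> Rintegrable g ->
  Rintegrable (fun x => f x + g x).
Proof. by move=> hf hg; exact: (eq_integrable mD _ _ _ (integrableD mD hf hg)). Qed.

Lemma RintegrableZ (k : R) (f : R -> R) : Rintegrable f ->
  Rintegrable (fun x => k * f x).
Proof. by move=> hf; exact: (eq_integrable mD _ _ _ (integrableZl mD k hf)). Qed.

Lemma RintegrableB (f g : R -> R) : Rintegrable f -> Rintegrable g ->
  Rintegrable (fun x => f x - g x).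
Proof. by move=> hf hg; exact: (eq_integrable mD _ _ _ (integrableB mD hf hg)). Qed.

Lemma Rintegrable_sum (I : Type) (r : seq I) (f : I -> R -> R) :
  (forall i, Rintegrable (f i)) -> Rintegrable (fun x => \sum_(i <- r) f i x).
Proof.
move=> hf; elim: r => [|i r IH].
  apply: (@eq_Rintegrable (cst 0)) => [x|]; first by rewrite big_nil.
  exact: integrable0.
apply: eq_Rintegrable (RintegrableD (hf i) IH) => x.
by rewrite big_cons.
Qed.

Lemma Rintegral_sum (I : Type) (r : seq I) (f : I -> R -> R) :
  (forall i, Rintegrable (f i)) ->
  Rintegral mu D (fun x => \sum_(i <- r) f i x)
  = \sum_(i <- r) Rintegral mu D (f i).
Proof.
move=> hf; elim: r => [|i r IH].
  rewrite big_nil -[RHS](mul0r (fine (mu D))) -Rintegral_cst//.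
  by apply: eq_Rintegral => x _; rewrite big_nil.
rewrite big_cons -IH -(RintegralD mD (hf i) (Rintegrable_sum r hf)).
by apply: eq_Rintegral => x _; rewrite big_cons.
Qed.

Lemma Rintegral_lin (a b : R) (f g : R -> R) : Rintegrable f -> Rintegrable g ->
  Rintegral mu D (fun x => a * f x + b * g x) =
  a * Rintegral mu D f + b * Rintegral mu D g.
Proof.
move=> hf hg.
rewrite (RintegralD mD (RintegrableZ a hf) (RintegrableZ b hg)).
by rewrite (RintegralZl _ mD hf) (RintegralZl _ mD hg).
Qed.

Lemma RintegrableM_bounded (h g : R -> R) : measurable_fun D h ->
  (forall x, `|h x| <= 1) -> Rintegrable g -> Rintegrable (fun x => h x * g x).
Proof.
move=> mh h1 hg; have := @integrableMr _ _ _ mu D mD h (EFin \o g) mh.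
move=> H; apply: H => //; exists 1; split => // e e1 x _ /=.
by apply: le_trans (h1 x) (ltW e1).
Qed.

Hypothesis finD : (mu D < +oo)%E.

Lemma Rintegrable_bounded (h : R -> R) : measurable_fun D h ->
  (forall x, `|h x| <= 1) -> Rintegrable h.
Proof.
move=> mh h1; apply: measurable_bounded_integrable => //.
exists 1; split => // e e1 x _ /=; exact: le_trans (h1 x) (ltW e1).
Qed.

Lemma le_Rintegrable (f g : R -> R) : measurable_fun D f ->
  (forall x, `|f x| <= g x) -> Rintegrable g -> Rintegrable f.
Proof.
move=> mf fg hg; apply: (le_integrable mD _ _ hg); first exact/measurable_EFinP.
move=> x _ /=; rewrite lee_fin (le_trans (fg x))//; exact: ler_norm.
Qed.

End Rintegrable.

(** * Complex integrals: linearity and measurability *)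

Section cintegral.
Variable R : realType.
Local Notation mu := (@lebesgue_measure R).
Variables (D : set (measurableTypeR R)) (mD : measurable D).

Definition cmeasurable (d : measure_display) (T : measurableType d)
    (A : set T) (f : T -> R[i]) :=
  measurable_fun A (fun x => complex.Re (f x)) /\
  measurable_fun A (fun x => complex.Im (f x)).

Definition cintegrable (f : R -> R[i]) :=
  Rintegrable D (fun x => complex.Re (f x)) /\
  Rintegrable D (fun x => complex.Im (f x)).

Lemma eq_cintegral (f g : R -> R[i]) : (forall x, D x -> f x = g x) ->
  cintegral D f = cintegral D g.
Proof.
move=> fg; rewrite /cintegral; congr Complex;
  by apply: eq_Rintegral => x /set_mem/fg ->.
Qed.

Lemma cintegralZ (c : R[i]) (f : R -> R[i]) : cintegrable f ->
  cintegral D (fun x => c * f x) = c * cintegral D f.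
Proof.
move=> [rf imf]; apply/eqP; rewrite eq_complex ReM ImM/=.
under eq_Rintegral do rewrite ReM.
under [X in _ && (X == _)]eq_Rintegral do rewrite ImM.
rewrite RintegralB ?RintegralD ?RintegralZl ?eqxx//; exact: RintegrableZ.
Qed.

Lemma cmeasurableM (d : measure_display) (T : measurableType d) (A : set T)
    (f g : T -> R[i]) :
  cmeasurable A f -> cmeasurable A g -> cmeasurable A (fun x => f x * g x).
Proof.
move=> [fr fi] [gr gi]; split.
  rewrite (_ : (fun x => _) = fun x => complex.Re (f x) * complex.Re (g x) -
      complex.Im (f x) * complex.Im (g x)).
    by apply: measurable_funB; apply: measurable_funM.
  by apply/funext => x; rewrite ReM.
rewrite (_ : (fun x => _) = fun x => complex.Re (f x) * complex.Im (g x) +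
    complex.Im (f x) * complex.Re (g x)).
  by apply: measurable_funD; apply: measurable_funM.
by apply/funext => x; rewrite ImM.
Qed.

Lemma cmeasurableB (d : measure_display) (T : measurableType d) (A : set T)
    (f g : T -> R[i]) :
  cmeasurable A f -> cmeasurable A g -> cmeasurable A (fun x => f x - g x).
Proof.
move=> [fr fi] [gr gi]; split.
  rewrite (_ : (fun x => _) = fun x => complex.Re (f x) - complex.Re (g x)).
    exact: measurable_funB.
  by apply/funext => x; case: (f x) => ? ?; case: (g x).
rewrite (_ : (fun x => _) = fun x => complex.Im (f x) - complex.Im (g x)).
  exact: measurable_funB.
by apply/funext => x; case: (f x) => ? ?; case: (g x).
Qed.

Lemma cmeasurable_expi (d : measure_display) (T : measurableType d)
    (th : T -> R) :
  measurable_fun setT th -> cmeasurable setT (fun x => expi (th x)).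
Proof.
move=> mth; split.
  exact: (measurableT_comp (continuous_measurable_fun (@continuous_cos R))).
exact: (measurableT_comp (continuous_measurable_fun (@continuous_sin R))).
Qed.

Lemma cmeasurable_cintegral_param (d : measure_display) (T : measurableType d)
    (g : T * R -> R[i]) : cmeasurable setT g ->
  cmeasurable setT (fun x => cintegral D (fun y => g (x, y))).
Proof.
move=> [gr gi]; split.
  exact: (measurable_Rintegral_param (g := fun z => complex.Re (g z))).
exact: (measurable_Rintegral_param (g := fun z => complex.Im (g z))).
Qed.

Lemma measurable_expi (w : R) (A : set (measurableTypeR R)) :
  measurable A -> cmeasurable A (fun x => expi (w * x)).
Proof.
move=> mA; have [mc ms] : cmeasurable setT (fun x : R => expi (w * x)).
  by apply: cmeasurable_expi; exact: measurable_funM.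
by split; exact: measurable_funTS.
Qed.

Lemma cintegrableM_expi (w : R) (f : R -> R[i]) : cintegrable f ->
  cintegrable (fun x => expi (w * x) * f x).
Proof.
move=> [rf imf]; have [mc ms] := measurable_expi w mD.
split.
  under eq_fun do rewrite ReM.
  by apply: RintegrableB => //; apply: RintegrableM_bounded => // x;
    [exact: cos_max|exact: sin_max].
under eq_fun do rewrite ImM.
by apply: RintegrableD => //; apply: RintegrableM_bounded => // x;
    [exact: cos_max|exact: sin_max].
Qed.

Lemma cmeasurable_normsq (d : measure_display) (T : measurableType d)
    (A : set T) (f : T -> R[i]) :
  cmeasurable A f -> measurable_fun A (fun x => normsq (f x)).
Proof. by move=> [mr mi]; apply: measurable_funD; exact: measurable_funX. Qed.

(** On a set of finite measure L^2 is contained in L^1, through [|a| <= 1 + a^2 + b^2]. *)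
Lemma cintegrable_L2 (f : R -> R[i]) : (mu D < +oo)%E -> cmeasurable D f ->
  Rintegrable D (fun x => normsq (f x)) -> cintegrable f.
Proof.
move=> finD [mr mi] h.
have h1 : Rintegrable D (fun x => 1 + normsq (f x)).
  by apply: RintegrableD => //; apply: Rintegrable_bounded => // x; rewrite normr1.
split; apply: le_Rintegrable h1 => // x.
  rewrite /normsq; move: (complex.Re _) (complex.Im _) => a b.
  have := sqr_ge0 (`|a| - 1); rewrite -(real_normK (num_real a)).
  by have := sqr_ge0 b; have := normr_ge0 a; nra.
rewrite /normsq; move: (complex.Re _) (complex.Im _) => a b.
have := sqr_ge0 (`|b| - 1); rewrite -(real_normK (num_real b)).
by have := sqr_ge0 a; have := normr_ge0 b; nra.
Qed.

End cintegral.

(** * Parseval and Bessel for finitely many orthogonal characters *)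

Section bessel.
Variable R : realType.
Local Notation mu := (@lebesgue_measure R).
Variables (D : set (measurableTypeR R)) (mD : measurable D) (T : R).
Hypothesis muD : mu D = T%:E.
Variables (M : nat) (w : 'I_M -> R).
Hypothesis orth_cos : forall k l, k != l ->
  Rintegral mu D (fun x => cos ((w k - w l) * x)) = 0.
Hypothesis orth_sin : forall k l, k != l ->
  Rintegral mu D (fun x => sin ((w k - w l) * x)) = 0.

Let finD : (mu D < +oo)%E. Proof. by rewrite muD ltry. Qed.

Let icos (v : R) : Rintegrable D (fun x => cos (v * x)).
Proof.
by apply: Rintegrable_bounded => //; [case: (measurable_expi v mD)|
  move=> x; exact: cos_max].
Qed.

Let isin (v : R) : Rintegrable D (fun x => sin (v * x)).
Proof.
by apply: Rintegrable_bounded => //; [case: (measurable_expi v mD)|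
  move=> x; exact: sin_max].
Qed.

Let Jcos k l : Rintegral mu D (fun x => cos ((w k - w l) * x)) =
  if k == l then T else 0.
Proof.
case: eqP => [->|/eqP/orth_cos//].
under eq_Rintegral do rewrite subrr mul0r cos0.
by rewrite Rintegral_cst// mul1r; exact: (congr1 fine muD).
Qed.

Let Jsin k l : Rintegral mu D (fun x => sin ((w k - w l) * x)) = 0.
Proof.
case: (eqVneq k l) => [->|/orth_sin//].
under eq_Rintegral do rewrite subrr mul0r sin0.
by rewrite Rintegral_cst// mul0r.
Qed.

Let A (c : 'I_M -> R[i]) k l :=
  complex.Re (c k) * complex.Re (c l) + complex.Im (c k) * complex.Im (c l).
Let B (c : 'I_M -> R[i]) k l :=
  complex.Re (c k) * complex.Im (c l) - complex.Im (c k) * complex.Re (c l).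

Let normsq_trigpoly (c : 'I_M -> R[i]) x :
  normsq (\sum_k c k * expi (w k * x)) = \sum_k \sum_l
    (A c k l * cos ((w k - w l) * x) + B c k l * sin ((w k - w l) * x)).
Proof.
rewrite normsq_sumE; apply: eq_bigr => k _; apply: eq_bigr => l _.
by rewrite /A /B !ReM !ImM /= [(w k - w l) * x]mulrBl cosB sinB; ring.
Qed.

Let itrig (c : 'I_M -> R[i]) k l : Rintegrable D (fun x =>
  A c k l * cos ((w k - w l) * x) + B c k l * sin ((w k - w l) * x)).
Proof. by apply: RintegrableD => //; apply: RintegrableZ. Qed.

Lemma Rintegrable_trigpoly (c : 'I_M -> R[i]) :
  Rintegrable D (fun x => normsq (\sum_k c k * expi (w k * x))).
Proof.
under eq_fun do rewrite normsq_trigpoly.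
by apply: Rintegrable_sum => // k; apply: Rintegrable_sum.
Qed.

Lemma parseval_trigpoly (c : 'I_M -> R[i]) :
  Rintegral mu D (fun x => normsq (\sum_k c k * expi (w k * x))) =
  T * \sum_k normsq (c k).
Proof.
under eq_Rintegral do rewrite normsq_trigpoly.
rewrite Rintegral_sum//; last by move=> k; apply: Rintegrable_sum.
rewrite mulr_sumr; apply: eq_bigr => k _.
rewrite Rintegral_sum//= (bigD1 k)//= big1 => [|l lk]; last first.
  rewrite Rintegral_lin//.
  by rewrite Jcos Jsin eq_sym (negbTE lk) !mulr0 addr0.
rewrite Rintegral_lin//.
rewrite Jcos Jsin eqxx /A /normsq; ring.
Qed.

(** With c_k the coefficients and P the sum of the [c_k e(w_k x)], the left side S is the integral
    of [Re(conj P * F)]. Pointwise this is at most [T/2 |F|^2 + |P|^2 / (2T)], and Parseval makes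
    the last integral S / 2, which moves to the left. Orthogonality is a hypothesis, so that the
    result serves both the torus and [[-K, K]]. *)
Lemma bessel (F : R -> R[i]) : 0 < T -> cmeasurable D F ->
  ((\sum_k normsq (cintegral D (fun x => expi (- (w k * x)) * F x)))%:E
   <= T%:E * \int[mu]_(x in D) (normsq (F x))%:E)%E.
Proof.
move=> T0 mF; have mN := cmeasurable_normsq mF.
(* F is only measurable; an infinite right-hand side is settled here, and otherwise F is in L^2,
   hence integrable. *)
have [->|] := eqVneq (\int[mu]_(x in D) (normsq (F x))%:E)%E +oo%E.
  by rewrite gt0_muley ?lte_fin// leey.
rewrite -ltey => Ify.
have iN : Rintegrable D (fun x => normsq (F x)).
  apply/integrableP; split; first exact/measurable_EFinP.
  by under eq_integral do rewrite /= ger0_norm ?normsq_ge0//.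
have iF := cintegrable_L2 mD finD mF iN.
have -> : (\int[mu]_(x in D) (normsq (F x))%:E =
   (Rintegral mu D (fun x => normsq (F x)))%:E)%E.
  by rewrite fineK//; exact: (integrable_fin_num mD iN).
rewrite -EFinM lee_fin.
have iE k : cintegrable D (fun x => expi (- (w k * x)) * F x).
  by under eq_fun do rewrite -mulNr; exact: cintegrableM_expi.
pose c k := cintegral D (fun x => expi (- (w k * x)) * F x).
set S := \sum_k _.
set I := Rintegral _ _ _.
pose G k x := complex.Re (c k) * complex.Re (expi (- (w k * x)) * F x) +
  complex.Im (c k) * complex.Im (expi (- (w k * x)) * F x).
have iG k : Rintegrable D (G k).
  by have [h1 h2] := iE k; apply: RintegrableD => //; apply: RintegrableZ.
have SE : S = Rintegral mu D (fun x => \sum_k G k x).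
  rewrite Rintegral_sum//; apply: eq_bigr => k _; have [h1 h2] := iE k.
  by rewrite (Rintegral_lin mD _ _ h1 h2) /normsq !expr2.
have le2 : S <= T / 2 * I + (2 * T)^-1 * (T * S).
  rewrite [X in _ * (T * X)](_ : S = \sum_k normsq (c k))//.
  rewrite -parseval_trigpoly -Rintegral_lin//; last exact: Rintegrable_trigpoly.
  rewrite SE; apply: le_Rintegral => //.
  - exact: Rintegrable_sum.
  - by apply: RintegrableD => //; apply: RintegrableZ => //;
      exact: Rintegrable_trigpoly.
  move=> x _; set P := \sum_k _ * _.
  have -> : \sum_k G k x = complex.Re P * complex.Re (F x) +
      complex.Im P * complex.Im (F x).
    rewrite /P Re_sum Im_sum !mulr_suml -big_split/=; apply: eq_bigr => k _.
    by rewrite /G !ReM !ImM/= cosN sinN; ring.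
  rewrite /normsq; move: (complex.Re P) (complex.Im P) => p q.
  move: (complex.Re _) (complex.Im _) => a b.
  rewrite -subr_ge0.
  have -> : T / 2 * (a ^+ 2 + b ^+ 2) + (2 * T)^-1 * (p ^+ 2 + q ^+ 2) -
    (p * a + q * b) = (2 * T)^-1 * ((T * a - p) ^+ 2 + (T * b - q) ^+ 2).
    by field; rewrite gt_eqF.
  by rewrite mulr_ge0 ?invr_ge0 ?mulr_ge0 ?(ltW T0)// addr_ge0 ?sqr_ge0.
move: le2; have -> : (2 * T)^-1 * (T * S) = S / 2 by field; rewrite gt_eqF.
by move=> h; lra.
Qed.

End bessel.

(** * Vanishing of trigonometric integrals over whole periods *)

Section trigonometric_orthogonality.
Variable R : realType.
Local Notation mu := (@lebesgue_measure R).

Lemma Rintegral_FTC (F f : R -> R) (a b : R) : a < b -> continuous f ->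
  (forall x : R, is_derive x (1 : R) F (f x)) ->
  Rintegral mu `[a, b]%classic f = F b - F a.
Proof.
move=> ab cf dF.
have dF' x : derivable F x 1 by have := dF x => -[].
have cF : continuous F.
  by move=> x; apply: differentiable_continuous; exact/derivable1_diffP.
rewrite /Rintegral (continuous_FTC2 (F := F) ab)//.
- by apply: continuous_subspaceT => x; exact: cf.
- split => [x _||]; first exact: dF'.
  + by apply: cvg_at_right_filter; exact: cF.
  + by apply: cvg_at_left_filter; exact: cF.
- by move=> x _; rewrite derive1E; exact: derive_val.
Qed.

Section orthogonality.
Variables (a b v : R) (k : int).
Hypotheses (ab : a < b) (v0 : v != 0) (vk : v * (b - a) = 2 * pi * k%:~R).

Let expi_period : expi (v * b) = expi (v * a).
Proof.
have -> : v * b = v * a + v * (b - a) by ring.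
by rewrite expiD vk expi_2pi_int mulr1.
Qed.

(** The interval has length a multiple of the period, so the primitive takes equal values at its two
    ends. *)
Lemma Rintegral_cos_period :
  Rintegral mu `[a, b]%classic (fun x => cos (v * x)) = 0.
Proof.
have dF (x : R) : is_derive x (1 : R) (fun x => v^-1 * sin (v * x)) (cos (v * x)).
  have h : is_derive x (1 : R) (fun y : R => v * y) v.
    by have := is_deriveZ v (is_derive_id x (1 : R)); rewrite /GRing.scale/= mulr1.
  have := is_deriveZ v^-1 (is_derive1_comp (is_derive_sin (v * x)) h).
  by rewrite /GRing.scale/= mulrCA mulVf// mulr1.
have cf : continuous (fun x => cos (v * x)).
  move=> x; apply: continuous_comp; last exact: continuous_cos.
  by apply: cvgM; [exact: cvg_cst|exact: cvg_id].
rewrite (Rintegral_FTC ab cf dF).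
have /(congr1 (@complex.Im R))/= -> := expi_period; exact: subrr.
Qed.

Lemma Rintegral_sin_period :
  Rintegral mu `[a, b]%classic (fun x => sin (v * x)) = 0.
Proof.
have dF (x : R) : is_derive x (1 : R) (fun x => (- v^-1) * cos (v * x)) (sin (v * x)).
  have h : is_derive x (1 : R) (fun y : R => v * y) v.
    by have := is_deriveZ v (is_derive_id x (1 : R)); rewrite /GRing.scale/= mulr1.
  have := is_deriveZ (- v^-1) (is_derive1_comp (is_derive_cos (v * x)) h).
  by rewrite /GRing.scale/= mulrCA [- _ * v]mulNr mulrNN mulVf// mulr1.
have cf : continuous (fun x => sin (v * x)).
  move=> x; apply: continuous_comp; last exact: continuous_sin.
  by apply: cvgM; [exact: cvg_cst|exact: cvg_id].
rewrite (Rintegral_FTC ab cf dF).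
have /(congr1 (@complex.Re R))/= -> := expi_period; exact: subrr.
Qed.

End orthogonality.

End trigonometric_orthogonality.

(** * Plancherel's inequality for functions on a bounded interval *)

Section plancherel.
Variable R : realType.
Local Notation mu := (@lebesgue_measure R).

(** Folding: a long window is cut into M translates of one cell. The integrand becomes a sum over an
    arithmetic progression of frequencies, the form in which Bessel's inequality can be used. *)
Lemma ge0_integral_window (h b : R) (M : nat) (G : R -> \bar R) : 0 < h ->
  measurable_fun setT G -> (forall x, 0 <= G x)%E ->
  (\int[mu]_(x in `[b, (b + h * M%:R)%R[%classic) G x =
   \int[mu]_(x in `[b, (b + h)%R[%classic) \sum_(k < M) G (x + h * k%:R)%R)%E.
Proof.
move=> h0 mG G0.
have mGs (c : R) : measurable_fun [set: R] (fun x : R => G (x + c)).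
  apply: (measurableT_comp mG); exact: (measurable_funD).
rewrite ge0_integral_sum//; last first.
  by move=> k; exact: (measurable_funTS (mGs _)).
elim: M => [|M IH].
  by rewrite mulr0 addr0 set_itvco0 integral_set0 big_ord0.
rewrite big_ord_recr/= -IH.
have bM : b <= b + h * M%:R by rewrite lerDl mulr_ge0// ltW.
have bMS : b + h * M%:R <= b + h * M.+1%:R.
  by rewrite lerD2l ler_pM2l// ler_nat.
rewrite (@itv_bndbnd_setU _ _ _ (BLeft (b + h * M%:R)))//.
rewrite ge0_integral_setU//=; first last.
- rewrite disj_set2E; apply/eqP/seteqP; split=> // x [] /=.
  by rewrite !in_itv/= => /andP[_ ?] /andP[]; rewrite leNgt => /negP.
- exact: measurable_funTS.
congr (_ + _)%E; rewrite integral_mkcond [RHS]integral_mkcond.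
rewrite -(ge0_integral_translation (h * M%:R)); last 2 first.
- by apply/(measurable_restrictT _ _).1 => //; exact: measurable_funTS.
- by move=> x; apply: erestrict_ge0.
apply: eq_integral => x _; rewrite !patchE.
have -> // : (x + h * M%:R \in `[b + h * M%:R, b + h * M.+1%:R[%classic) =
   (x \in `[b, b + h[%classic).
rewrite -natr1 mulrDr mulr1.
apply/idP/idP; rewrite !inE/= !in_itv/= => /andP[h1 h2]; apply/andP; split; lra.
Qed.

Variables (e : int) (e0 : e != 0) (K : R) (K0 : 0 < K).
Variables (F : R -> R[i]) (mF : cmeasurable [set: R] F).

Let D : set (measurableTypeR R) := `[- K, K]%classic.
Let mD : measurable D. Proof. exact: measurable_itv. Qed.
Let T := 2 * K.
Let T0 : 0 < T. Proof. by rewrite mulr_gt0. Qed.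

(** The integer [e] carries the sign of the exponent: -1 gives the truncated Fourier transform, 1
    the inverse transform of a compactly supported symbol. *)
Definition cfourier (xi : R) : R[i] :=
  cintegral D (fun x => expi (e%:~R * (2 * pi * (xi * x))) * F x).

Lemma measurable_cfourier : cmeasurable [set: R] cfourier.
Proof.
apply: (cmeasurable_cintegral_param mD (g := fun z : R * R =>
  expi (e%:~R * (2 * pi * (z.1 * z.2))) * F z.2)).
apply: cmeasurableM.
  apply: cmeasurable_expi; apply: measurable_funM => //; apply: measurable_funM => //.
  exact: measurable_funM.
by case: mF => mr mi; split;
  [exact: (measurableT_comp mr)|exact: (measurableT_comp mi)].
Qed.

(* The characters of frequencies [xi + k / T] are orthogonal on [[-K, K]].
   Integrating the resulting bound over a window of [xi] of length [1 / T] gives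
   Plancherel's inequality. *)
Lemma bessel_cfourier (M : nat) (xi : R) :
  ((\sum_(k < M) normsq (cfourier (xi + T^-1 * k%:R)))%:E <=
  T%:E * \int[mu]_(x in D) (normsq (F x))%:E)%E.
Proof.
pose w (k : 'I_M) := - (e%:~R * (2 * pi * (xi + T^-1 * k%:R))).
have wE k l : (w k - w l) * (K - - K) = 2 * pi * (e * (l%:Z - k%:Z))%:~R.
  have Kn : K != 0 by rewrite gt_eqF.
  rewrite /w /T intrM intrB; field.
  by rewrite Kn.
have w0 k l : k != l -> w k - w l != 0.
  move=> kl; apply/eqP => h; move: (wE k l); rewrite h mul0r => /esym/eqP.
  rewrite !mulf_eq0 pnatr_eq0/= gt_eqF ?pi_gt0//= intr_eq0 mulf_eq0 (negbTE e0)/=.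
  by rewrite subr_eq0 eq_sym => /eqP [] /val_inj/eqP; rewrite (negbTE kl).
have NK : - K < K by rewrite gtrN.
have muD : mu D = T%:E.
  by rewrite lebesgue_measure_itv/= lte_fin NK -EFinB; congr EFin; rewrite /T; ring.
have -> : \sum_(k < M) normsq (cfourier (xi + T^-1 * k%:R)) =
    \sum_k normsq (cintegral D (fun x => expi (- (w k * x)) * F x)).
  apply: eq_bigr => k _; congr normsq; apply: eq_cintegral => x _.
  by congr (expi _ * _); rewrite /w; ring.
apply: bessel => //.
- by move=> k l kl; apply: (Rintegral_cos_period NK (w0 _ _ kl) (wE k l)).
- by move=> k l kl; apply: (Rintegral_sin_period NK (w0 _ _ kl) (wE k l)).
- by case: mF => mr mi; split; exact: measurable_funTS.
Qed.

(** The cell length [T^-1] cancels the factor T of Bessel's inequality, so the bound on a window of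
    M cells does not depend on M. Symmetric windows then exhaust the line by monotone
    convergence. *)
Lemma plancherel_le :
  (\int[mu]_xi (normsq (cfourier xi))%:E <=
   \int[mu]_(x in D) (normsq (F x))%:E)%E.
Proof.
set I := (X in (_ <= X)%E).
have [->|] := eqVneq I +oo%E; first by rewrite leey.
have I0 : (0 <= I)%E by apply: integral_ge0 => x _; rewrite lee_fin normsq_ge0.
rewrite -ltey -ge0_fin_numE// => finI.
pose G (xi : R) : \bar R := (normsq (cfourier xi))%:E.
have mG : measurable_fun setT G.
  by apply/measurable_EFinP; exact: cmeasurable_normsq measurable_cfourier.
have G0 x : (0 <= G x)%E by rewrite lee_fin normsq_ge0.
pose h := T^-1; have h0 : 0 < h by rewrite invr_gt0.
have window b M : (\int[mu]_(x in `[b, (b + h * M%:R)%R[%classic) G x <= I)%E.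
  rewrite ge0_integral_window//.
  apply: (@le_trans _ _ (\int[mu]_(x in `[b, (b + h)%R[%classic) (T%:E * I)))%E.
    apply: le_integral_ge0 => x _; first by apply: sume_ge0.
    by rewrite sumEFin; exact: bessel_cfourier.
  rewrite integral_cst//= lebesgue_measure_itv/= lte_fin ltrDl h0.
  rewrite -EFinB addrAC subrr add0r.
  by rewrite muleAC -EFinM mulfV ?mul1e// gt_eqF.
pose S (m : nat) : set (measurableTypeR R) := `[- (h * m%:R), h * m%:R[%classic.
have cvgS := @ge0_nondecreasing_set_cvg_integral _ _ R S G mu.
have -> : [set: R] = \bigcup_i S i.
  apply/esym; rewrite -subTset => x _.
  exists (Num.truncn (T * `|x|)).+1 => //; rewrite /S/= in_itv/=.
  have xlt : `|x| < h * (Num.truncn (T * `|x|)).+1%:R.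
    by rewrite /h mulrC ltr_pdivlMr// mulrC truncnS_gt.
  by move: xlt; rewrite ltr_norml => /andP[/ltW -> ->].
have {}cvgS : (\int[mu]_(x in S i) G x @[i --> \oo] -->
    \int[mu]_(x in \bigcup_i S i) G x)%E.
  apply: cvgS => //.
  - apply/nondecreasing_seqP => n; rewrite subsetEset => x; rewrite /S/= !in_itv/=.
    have : h * n%:R <= h * n.+1%:R by rewrite ler_pM2l// ler_nat.
    move=> hh /andP[h1 h2]; apply/andP; split; lra.
  - by move=> i; exact: measurable_itv.
  - by move=> i; exact: (measurable_funTS mG).
rewrite -(cvg_lim (@ereal_hausdorff R) cvgS).
apply: lime_le; first by apply/cvg_ex; eexists; exact: cvgS.
apply: nearW => n; have := window (- (h * n%:R)) (2 * n)%N.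
have -> // : - (h * n%:R) + h * (2 * n)%:R = h * n%:R by rewrite natrM; ring.
Qed.

End plancherel.

(** * Harmonic sums *)

Section harmonic.
Variable R : realType.

(** The term of index 0 is [0^-1 = 0], so this is the usual n-th harmonic number. *)
Definition harmonic_sum (n : nat) : R := \sum_(k < n.+1) k%:R^-1.

(** By [ln (1 + x) <= x] at [x = - 1/(n+2)], each new term [1/(n+2)] is at most
    [ln (n+2) - ln (n+1)]. *)
Lemma harmonic_sum_le (n : nat) : harmonic_sum n.+1 <= 1 + ln n.+1%:R.
Proof.
elim: n => [|n IH].
  by rewrite /harmonic_sum !big_ord_recr big_ord0/= invr0 !add0r invr1 ln1 addr0.
rewrite /harmonic_sum big_ord_recr/= -/(harmonic_sum n.+1).
have n1 : 0 < n.+1%:R :> R by rewrite ltr0n.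
have n2 : 0 < n.+2%:R :> R by rewrite ltr0n.
have h : ln (n.+1%:R / n.+2%:R) <= - n.+2%:R^-1 :> R.
  have -> : n.+1%:R / n.+2%:R = 1 + - n.+2%:R^-1 :> R.
    have -> : n.+1%:R = n.+2%:R - 1 :> R by rewrite -[n.+2%:R]natr1 addrK.
    by rewrite mulrBl mulfV ?gt_eqF// mul1r.
  apply: le_ln1Dx; rewrite ltrN2 invf_lt1 ?ltr1n//.
move: h; rewrite lnM ?posrE ?invr_gt0// lnV ?posrE//.
move: IH; move: (ln _) (ln _) (_^-1) (harmonic_sum _) => a b c d.
by move=> IH h; lra.
Qed.

Lemma harmonic_sum_ge1 (n : nat) : 1 <= harmonic_sum n.+1.
Proof.
rewrite /harmonic_sum !big_ord_recl/= invr0 add0r invr1 lerDl.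
by apply: sumr_ge0 => i _; rewrite invr_ge0.
Qed.

(** Distinct denominators not exceeding n select a sub-sum of the harmonic sum, all of whose terms
    are nonnegative. *)
Lemma sum_inv_inj_le (I : finType) (P : pred I) (n : nat) (u : I -> nat) :
  (forall i, P i -> u i <= n)%N -> {in P &, injective u} ->
  \sum_(i | P i) (u i)%:R^-1 <= harmonic_sum n.
Proof.
move=> un uinj.
pose v i : 'I_n.+1 := inord (u i).
have vE i : P i -> v i = u i :> nat by move=> Pi; rewrite inordK// ltnS un.
have vinj : {in [pred i | P i] &, injective v}.
  move=> i j Pi Pj /(congr1 val)/=; rewrite !vE//; exact: uinj.
have -> : \sum_(i | P i) (u i)%:R^-1 = \sum_(i in [pred i | P i]) (v i)%:R^-1 :> R.
  by apply: eq_bigr => i Pi; rewrite vE.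
rewrite -(big_imset (fun k : 'I_n.+1 => k%:R^-1 : R) vinj)/= /harmonic_sum.
rewrite [leRHS](bigID (mem (v @: [pred i | P i])))/= lerDl.
by apply: sumr_ge0 => i _; rewrite invr_ge0.
Qed.

End harmonic.

(** * The Cauchy-Schwarz weights on pairs of frequencies *)

Section weights.
Variable R : realType.
Variables (M : nat).
Implicit Types (i j : 'I_M).

Let L : R := 2 * harmonic_sum R (2 * M).

(* The diagonal weight [1 / L] offsets the factor [2 L] of [sum_weight_inv_le], so
   that the diagonal terms lose no logarithm. *)
Definition weight i j : R := if i == j then L^-1 else `|i%:R - j%:R|.

Lemma weight_gt0 i j : 0 < weight i j.
Proof.
have M0 : (0 < M)%N by case: M i {j} => // -[].
rewrite /weight; case: eqVneq => [_|ij].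
  rewrite invr_gt0 mulr_gt0//; apply: lt_le_trans ltr01 _.
  by rewrite (_ : 2 * M = (2 * M).-1.+1)%N ?harmonic_sum_ge1// prednK// muln_gt0.
by rewrite normr_gt0 subr_eq0 eqr_nat.
Qed.

(** On the line [i + j = s] the index i determines j, and [|i - j| = |2i - s|]. These values are
    distinct on each side of [s/2], so each side contributes at most a harmonic sum and both
    together at most L; the diagonal pair, if any, contributes L more. *)
Lemma sum_weight_inv_le (s : nat) : (s <= 2 * M)%N ->
  \sum_(p : 'I_M * 'I_M | (p.1 + p.2 == s)%N) (weight p.1 p.2)^-1 <= 2 * L.
Proof.
move=> sM; have H0 : 0 <= harmonic_sum R (2 * M).
  by apply: sumr_ge0 => k _; rewrite invr_ge0.
have L0 : 0 <= L by rewrite mulr_ge0.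
(* The inverse weight as a function of i alone. It is nonnegative, so it also bounds the empty inner
   sum when no j completes i to s. *)
pose g i : R := if (2 * i == s)%N then L else
  if (2 * i < s)%N then (s - 2 * i)%:R^-1 else (2 * i - s)%:R^-1.
have g0 i : 0 <= g i.
  by rewrite /g; case: ifP => // _; case: ifP => _; rewrite invr_ge0.
rewrite -(pair_big_dep xpredT (fun i j => (i + j == s)%N)
  (fun i j => (weight i j)^-1))/=.
apply: (@le_trans _ _ (\sum_i g i)).
  apply: ler_sum => i _.
  have wg j : (i + j == s)%N -> (weight i j)^-1 = g i.
    move=> /eqP ijs; rewrite /weight /g.
    have [ij|ij] := eqVneq i j.
      by rewrite -ijs ij mul2n addnn eqxx invrK.
    have nij : (i : nat) != j by [].
    rewrite -ijs; have -> : (2 * i == i + j)%N = false by lia.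
    case: ltnP => h; congr (_^-1).
      have -> : (i + j - 2 * i = j - i)%N by lia.
      rewrite natrB; last by lia.
      by rewrite ltr0_norm ?opprB// subr_lt0 ltr_nat; lia.
    have -> : (2 * i - (i + j) = i - j)%N by lia.
    rewrite natrB; last by lia.
    by rewrite gtr0_norm// subr_gt0 ltr_nat; lia.
  have [j0 j0s|] := pickP (fun j => (i + j == s)%N); last first.
    by move=> h; rewrite big_pred0.
  rewrite (big_pred1 j0) ?wg// => j.
  apply/eqP/eqP => [h|->]; last exact/eqP.
  by apply: val_inj => /=; move: j0s => /eqP; lia.
rewrite (bigID (fun i => (2 * i == s)%N))/= mulr_natl mulr2n lerD//.
  have [i0 i0s|] := pickP (fun i : 'I_M => (2 * i == s)%N); last first.
    by move=> h; rewrite big_pred0.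
  rewrite (big_pred1 i0) /g ?i0s// => i.
  apply/eqP/eqP => [h|->]; last exact/eqP.
  by apply: val_inj => /=; move: i0s => /eqP; lia.
rewrite (bigID (fun i => (2 * i < s)%N))/= /L mulr_natl mulr2n lerD//.
  under eq_bigr => i /andP[/negbTE h1 h2] do rewrite /g h1 h2.
  apply: sum_inv_inj_le => [i _|i j]; first by lia.
  by move=> /andP[? ?] /andP[? ?] h; apply: val_inj => /=; lia.
under eq_bigr => i /andP[/negbTE h1 /negbTE h2] do rewrite /g h1 h2.
apply: sum_inv_inj_le => [i _|i j]; first by have := ltn_ord i; lia.
by move=> /andP[? ?] /andP[? ?] h; apply: val_inj => /=; lia.
Qed.

End weights.

(** * The L^4 norm of a trigonometric polynomial on the torus *)

Section torus.
Variable R : realType.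
Local Notation mu := (@lebesgue_measure R).

Lemma torus_orth (k l : int) : k != l ->
  Rintegral mu (@torus_dom R)
    (fun x => cos ((2 * pi * k%:~R - 2 * pi * l%:~R) * x)) = 0 /\
  Rintegral mu (@torus_dom R)
    (fun x => sin ((2 * pi * k%:~R - 2 * pi * l%:~R) * x)) = 0.
Proof.
move=> kl; pose v : R := 2 * pi * k%:~R - 2 * pi * l%:~R; rewrite -/v.
have vE : v * (1 - 0) = 2 * pi * (k - l)%:~R by rewrite /v intrB; ring.
have v0 : v != 0.
  apply/eqP => h; move: vE; rewrite h mul0r => /esym/eqP.
  rewrite !mulf_eq0 pnatr_eq0/= gt_eqF ?pi_gt0//= intr_eq0 subr_eq0.
  by rewrite (negbTE kl).
have mD : measurable (@torus_dom R : set (measurableTypeR R)).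
  exact: measurable_itv.
have finD : (mu (@torus_dom R) < +oo)%E.
  by rewrite /torus_dom lebesgue_measure_itv/= lte_fin ltr01 -EFinB ltry.
split.
  rewrite /torus_dom Rintegral_itv_bndo_bndc.
    exact: (Rintegral_cos_period ltr01 v0 vE).
  apply: (Rintegrable_bounded mD finD) => [|x]; last exact: cos_max.
  by case: (measurable_expi v mD).
rewrite /torus_dom Rintegral_itv_bndo_bndc.
  exact: (Rintegral_sin_period ltr01 v0 vE).
apply: (Rintegrable_bounded mD finD) => [|x]; last exact: sin_max.
by case: (measurable_expi v mD).
Qed.

Lemma mu_torus_dom : mu (@torus_dom R) = 1%:E.
Proof. by rewrite /torus_dom lebesgue_measure_itv/= lte_fin ltr01 -EFinB subr0. Qed.

Lemma parseval_torus (M : nat) (c : 'I_M -> R[i]) :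
  (\int[mu]_(y in @torus_dom R)
     (normsq (\sum_k c k * expi (2 * pi * (k%:R * y))))%:E =
   (\sum_k normsq (c k))%:E)%E.
Proof.
have mD : measurable (@torus_dom R : set (measurableTypeR R)).
  exact: measurable_itv.
pose w (k : 'I_M) : R := 2 * pi * (Posz k)%:~R.
have oc (k l : 'I_M) : k != l ->
  Rintegral mu (@torus_dom R) (fun x => cos ((w k - w l) * x)) = 0.
  by move=> kl; case: (@torus_orth k l).
have os (k l : 'I_M) : k != l ->
  Rintegral mu (@torus_dom R) (fun x => sin ((w k - w l) * x)) = 0.
  by move=> kl; case: (@torus_orth k l).
have := parseval_trigpoly mD mu_torus_dom oc os c.
rewrite mul1r => <-.
rewrite fineK; last first.
  exact: (integrable_fin_num mD (Rintegrable_trigpoly mD mu_torus_dom w c)).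
apply: eq_integral => y _; congr (normsq _)%:E.
by apply: eq_bigr => k _; rewrite /w mulrA.
Qed.

Lemma normsq_sqr_trigpoly (M : nat) (h : 'I_M -> R[i]) (y : R) :
  normsq (\sum_k h k * expi (2 * pi * (k%:R * y))) ^+ 2 =
  normsq (\sum_(s < (2 * M).+1)
    (\sum_(p : 'I_M * 'I_M | (p.1 + p.2 == s)%N) h p.1 * h p.2)
      * expi (2 * pi * (s%:R * y))).
Proof.
rewrite expr2 -normsqM; congr normsq.
pose E (n : nat) := expi (2 * pi * (n%:R * y)) : R[i].
(* [inord] turns [i + j] into a total map to ordinals, as needed to partition the pairs; since
   [i + j < 2M] it truncates nothing. *)
rewrite [RHS](_ : _ = \sum_(s < (2 * M).+1)
    \sum_(p : 'I_M * 'I_M | inord (p.1 + p.2) == s :> 'I_(2 * M).+1)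
    h p.1 * h p.2 * E (p.1 + p.2)%N); last first.
  apply: eq_bigr => s _; rewrite mulr_suml.
  have eqs (p : 'I_M * 'I_M) :
      (inord (p.1 + p.2) == s :> 'I_(2 * M).+1) = (p.1 + p.2 == s)%N.
    rewrite -val_eqE/= inordK//.
    by have := ltn_ord p.1; have := ltn_ord p.2; lia.
  under [RHS]eq_bigl do rewrite eqs.
  by apply: eq_bigr => p /eqP ->.
transitivity (\sum_(p : 'I_M * 'I_M) h p.1 * h p.2 * E (p.1 + p.2)%N); last first.
  by rewrite (partition_big (fun p : 'I_M * 'I_M =>
    inord (p.1 + p.2) : 'I_(2 * M).+1) xpredT).
rewrite -(pair_big xpredT xpredT (fun i j => h i * h j * E (i + j)%N))/=.
rewrite mulr_suml; apply: eq_bigr => i _; rewrite mulr_sumr.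
apply: eq_bigr => j _.
have -> : E (i + j)%N = E i * E j.
  by rewrite -expiD; congr expi; rewrite (natrD _ i j); ring.
rewrite /E; ring.
Qed.

Lemma integral_trigpoly4_le (M : nat) (h : 'I_M -> R[i]) :
  (\int[mu]_(y in @torus_dom R)
     (normsq (\sum_k h k * expi (2 * pi * (k%:R * y))) ^+ 2)%:E <=
   (4 * harmonic_sum R (2 * M) *
     \sum_(p : 'I_M * 'I_M)
       weight R p.1 p.2 * (normsq (h p.1) * normsq (h p.2)))%:E)%E.
Proof.
under eq_integral do rewrite normsq_sqr_trigpoly.
rewrite parseval_torus lee_fin.
(* The factor is the [2 * L] of [sum_weight_inv_le] with L unfolded, the same for all s. *)
apply: (@le_trans _ _ (\sum_(s < (2 * M).+1) 2 * (2 * harmonic_sum R (2 * M)) *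
   \sum_(p : 'I_M * 'I_M | (p.1 + p.2 == s)%N)
     weight R p.1 p.2 * (normsq (h p.1) * normsq (h p.2)))).
  apply: ler_sum => s _.
  apply: le_trans (normsq_sum_le _ (w := fun p => weight R p.1 p.2) _ _) _.
    by move=> p _; exact: weight_gt0.
  under [X in _ * X <= _]eq_bigr do rewrite normsqM.
  apply: ler_wpM2r; last by apply: sum_weight_inv_le; rewrite -ltnS ltn_ord.
  apply: sumr_ge0 => p _; rewrite mulr_ge0 ?mulr_ge0 ?normsq_ge0//.
  exact/ltW/weight_gt0.
rewrite -mulr_sumr mulrA -natrM le_eqVlt; apply/orP; left; apply/eqP.
congr (_ * _).
rewrite [RHS](partition_big
  (fun p : 'I_M * 'I_M => inord (p.1 + p.2) : 'I_(2 * M).+1) xpredT)//=.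
apply: eq_bigr => s _; apply: eq_bigl => p.
rewrite -val_eqE/= inordK//.
by have := ltn_ord p.1; have := ltn_ord p.2; lia.
Qed.

End torus.

(** * Space-time integrals of products of travelling waves *)

Section travelling_waves.
Variable R : realType.
Local Notation mu := (@lebesgue_measure R).

Lemma integral_setT_ge0_le (D : set R) (f : R -> \bar R) :
  (forall x, 0 <= f x)%E -> (\int[mu]_(x in D) f x <= \int[mu]_x f x)%E.
Proof.
move=> f0; rewrite integral_mkcond; apply: le_integral_ge0 => x _.
  exact: erestrict_ge0.
by rewrite patchE; case: ifP.
Qed.

Lemma measurable_wave (p : R -> \bar R) (a b : R) : measurable_fun setT p ->
  measurable_fun [set: R * R] (fun z : R * R => p (a * z.1 + b * z.2)).
Proof.
move=> mp; apply: (measurableT_comp mp).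
by apply: measurable_funD; apply: measurable_funM.
Qed.

(* The pair (t, x) is recovered linearly, with Jacobian [|a - b|^-1], from the
   two characteristic coordinates [x - a t] and [x - b t]. *)
Lemma integral_waves (p q : R -> \bar R) (a b : R) : a != b ->
  measurable_fun setT p -> measurable_fun setT q ->
  (forall x, 0 <= p x)%E -> (forall x, 0 <= q x)%E ->
  (\int[mu]_t \int[mu]_x (p (x - a * t)%R * q (x - b * t)%R) =
   (`|a - b|^-1)%:E * (\int[mu]_x p x * \int[mu]_x q x))%E.
Proof.
move=> ab mp mq p0 q0.
have ab0 : a - b != 0 by rewrite subr_eq0.
(* Translating x by [a t] makes the first wave stationary; after Tonelli the t-integral sees only
   the second, affinely with slope [a - b]. The coefficients 0 and 1 fit [measurable_wave]. *)
pose f (z : R * R) := (p (0 * z.1 + 1 * z.2)%R * q ((a - b) * z.1 + 1 * z.2)%R)%E.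
have mf : measurable_fun setT f.
  by apply: emeasurable_funM; exact: measurable_wave.
have f0 z : (0 <= f z)%E by rewrite mule_ge0.
transitivity (\int[mu]_t \int[mu]_x f (t, x))%E.
  apply: eq_integral => t _.
  rewrite -(ge0_integral_translation (a * t)).
  - apply: eq_integral => x _; rewrite /f/=; congr (p _ * q _)%E; ring.
  - apply: emeasurable_funM.
      by apply: (measurableT_comp mp); exact: measurable_funB.
    by apply: (measurableT_comp mq); exact: measurable_funB.
  - by move=> x; rewrite mule_ge0.
transitivity (\int[mu]_x \int[mu]_t f (t, x))%E.
  exact: (@fubini_tonelli _ _ _ _ _ mu mu f mf f0).
transitivity (\int[mu]_x (p x * ((`|a - b|^-1)%:E * \int[mu]_x q x)))%E.
  apply: eq_integral => x _; rewrite -(ge0_integral_affine x ab0 mq q0).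
  rewrite -ge0_integralZl//.
    by apply: eq_integral => t _; rewrite /f/= mul0r add0r !mul1r.
  by apply: (measurableT_comp mq); exact: measurable_affine.
under eq_integral do rewrite muleC.
rewrite ge0_integralZl//; first by rewrite -muleA; congr (_ * _)%E; exact: muleC.
by rewrite mule_ge0 ?lee_fin ?invr_ge0//; exact: integral_ge0.
Qed.

(** Two waves of equal speed never separate: one factor is bounded by its supremum B, the other
    integrates to at most A at each time, and the time interval has length 1. *)
Lemma integral_wave_sqr (p : R -> R) (a B A : R) :
  measurable_fun setT p -> (forall x, 0 <= p x <= B) ->
  (\int[mu]_x (p x)%:E <= A%:E)%E ->
  (\int[mu]_(t in `[0%R, 1%R]%classic)
     \int[mu]_x ((p (x - a * t)%R)%:E * (p (x - a * t)%R)%:E)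
   <= (B * A)%:E)%E.
Proof.
move=> mp pB pA; have p0 x : 0 <= p x by have /andP[] := pB x.
have B0 : 0 <= B by have /andP[/le_trans] := pB 0; apply.
apply: (@le_trans _ _ (\int[mu]_(t in `[0%R, 1%R]%classic) (B * A)%:E))%E; last first.
  by rewrite integral_cst//= lebesgue_measure_itv/= lte_fin ltr01 -EFinB subr0 mule1.
apply: le_integral_ge0 => t _.
  by apply: integral_ge0 => x _; rewrite -EFinM lee_fin mulr_ge0.
apply: (@le_trans _ _ (\int[mu]_x (B%:E * (p (x - a * t))%:E)))%E.
  apply: le_integral_ge0 => x _; first by rewrite -EFinM lee_fin mulr_ge0.
  by rewrite -!EFinM lee_fin ler_wpM2r//; have /andP[] := pB (x - a * t).
have mE : measurable_fun setT (EFin \o p) by exact/measurable_EFinP.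
have m1 : measurable_fun [set: R] (fun x : R => (p (x - a * t))%:E).
  by apply: (measurableT_comp mE); exact: measurable_funB.
rewrite (@ge0_integralZl_EFin _ _ _ mu setT measurableT _ _ m1 _ B0); last first.
  by move=> x _; rewrite lee_fin.
rewrite EFinM lee_wpmul2l ?lee_fin//; apply: le_trans pA.
by rewrite (ge0_integral_translation (- (a * t)) mE) ?lexx// => x; rewrite lee_fin.
Qed.

Variables (M : nat) (g : 'I_M -> R -> R[i]) (a A B : 'I_M -> R).
Hypothesis M0 : (0 < M)%N.
Hypothesis mg : forall i, cmeasurable [set: R] (g i).
Hypothesis aE : forall i j : 'I_M, i != j -> `|i%:R - j%:R| <= `|a i - a j|.
Hypothesis gA : forall i, (\int[mu]_x (normsq (g i x))%:E <= (A i)%:E)%E.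
Hypothesis gB : forall i x, normsq (g i x) <= B i.

(** Off the diagonal [aE] lets the Jacobian [|a_i - a_j|^-1] cancel the weight [|i - j|]. On the
    diagonal the weight [(2H)^-1] turns the prefactor 4H into 2. *)
Lemma integral_waves4_le :
  (\int[mu]_(t in `[0%R, 1%R]%classic) \int[mu]_x \int[mu]_(y in @torus_dom R)
    (normsq (\sum_i g i (x - a i * t)%R * expi (2 * pi * (i%:R * y))) ^+ 2)%:E <=
   (4 * harmonic_sum R (2 * M) * (\sum_i A i) ^+ 2
    + 2 * \sum_i B i * A i)%:E)%E.
Proof.
set H := harmonic_sum _ _.
have H1 : 1 <= H.
  by rewrite /H (_ : 2 * M = (2 * M).-1.+1)%N ?harmonic_sum_ge1// prednK// muln_gt0.
have H0 : 0 < H by apply: lt_le_trans H1.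
pose p i x := normsq (g i x).
have p0 i x : 0 <= p i x by exact: normsq_ge0.
have mp i : measurable_fun setT (EFin \o p i).
  by apply/measurable_EFinP; exact: cmeasurable_normsq (mg i).
have A0 i : 0 <= A i.
  rewrite -lee_fin; apply: le_trans (gA i); apply: integral_ge0 => x _.
  by rewrite lee_fin normsq_ge0.
pose Q (s : 'I_M * 'I_M) (z : R * R) : \bar R :=
  ((p s.1 (z.2 - a s.1 * z.1))%:E * (p s.2 (z.2 - a s.2 * z.1))%:E)%E.
have mQ s : measurable_fun setT (Q s).
  apply: emeasurable_funM.
    apply: (measurableT_comp (mp s.1)); apply: measurable_funB => //.
    exact: measurable_funM.
  apply: (measurableT_comp (mp s.2)); apply: measurable_funB => //.
  exact: measurable_funM.
have Q0 s z : (0 <= Q s z)%E by rewrite mule_ge0// lee_fin.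
have wt0 s : (0 <= (4 * H * weight R s.1 s.2)%:E)%E.
  by rewrite lee_fin mulr_ge0 ?mulr_ge0 ?(ltW H0)//; exact/ltW/weight_gt0.
apply: (@le_trans _ _ (\int[mu]_(t in `[0%R, 1%R]%classic) \int[mu]_x
   \sum_(s : 'I_M * 'I_M) ((4 * H * weight R s.1 s.2)%:E * Q s (t, x))))%E.
  apply: le_integral_ge0 => t _.
    apply: integral_ge0 => x _; apply: integral_ge0 => y _.
    by rewrite lee_fin exprn_ge0// normsq_ge0.
  apply: le_integral_ge0 => x _.
    by apply: integral_ge0 => y _; rewrite lee_fin exprn_ge0// normsq_ge0.
  apply: (le_trans (integral_trigpoly4_le _)).
  rewrite mulr_sumr -sumEFin; apply: lee_sum => s _.
  by rewrite /Q -!EFinM lee_fin mulrA.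
have mQx s t : measurable_fun [set: measurableTypeR R]
    (fun x : measurableTypeR R => Q s (t, x)).
  by apply: (measurableT_comp (mQ s)); exact: measurable_fun_pair.
have mI s : measurable_fun [set: measurableTypeR R]
    (fun t : measurableTypeR R => \int[mu]_x Q s (t, x))%E.
  exact: (@measurable_fun_fubini_tonelli_F _ _ _ _ _ mu (Q s) (mQ s) (Q0 s)).
rewrite [leLHS](_ : _ = \int[mu]_(t in `[0%R, 1%R]%classic) \sum_(s : 'I_M * 'I_M)
   ((4 * H * weight R s.1 s.2)%:E * \int[mu]_x Q s (t, x)))%E; last first.
  apply: eq_integral => t _; rewrite ge0_integral_sum//.
  - apply: eq_bigr => s _.
    by rewrite ge0_integralZl//; exact: mQx.
  - by move=> s; apply: measurable_funeM.
  - by move=> s x _; rewrite mule_ge0.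
rewrite ge0_integral_sum//; last 2 first.
- move=> s; apply: measurable_funTS; exact: measurable_funeM.
- by move=> s t _; rewrite mule_ge0//; exact: integral_ge0.
(* The product [A_i A_j] is kept for equal indices too, so that the sum over all pairs factors as a
   square. *)
apply: (@le_trans _ _ (\sum_(s : 'I_M * 'I_M)
   (4 * H * (A s.1 * A s.2) + (if s.1 == s.2 then 2 * (B s.1 * A s.1) else 0))%:E)%E).
  apply: lee_sum => s _; rewrite ge0_integralZl//; last 2 first.
  - by apply: measurable_funTS.
  - by move=> t _; exact: integral_ge0.
  rewrite /weight; case: eqVneq => [s12|s12].
    apply: (@le_trans _ _ ((4 * H * (2 * H)^-1)%:E * (B s.1 * A s.1)%:E)%E).
      rewrite lee_wpmul2l ?lee_fin ?mulr_ge0 ?invr_ge0 ?mulr_ge0 ?(ltW H0)//.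
      rewrite /Q -s12; apply: integral_wave_sqr => //.
        exact: cmeasurable_normsq (mg _).
        by move=> x; rewrite p0 gB.
      exact: gA.
    rewrite -EFinM lee_fin -[leLHS]add0r lerD ?mulr_ge0 ?(ltW H0)//.
    by rewrite (_ : 4 * H * (2 * H)^-1 = 2)//; field; rewrite gt_eqF.
  rewrite addr0; have as12 : 0 < `|a s.1 - a s.2|.
    apply: lt_le_trans (aE s12); rewrite normr_gt0 subr_eq0 eqr_nat.
    exact: s12.
  apply: (@le_trans _ _ ((4 * H * `|s.1%:R - s.2%:R|)%:E *
     ((`|a s.1 - a s.2|^-1)%:E * ((A s.1)%:E * (A s.2)%:E)))%E).
    rewrite lee_wpmul2l ?lee_fin ?mulr_ge0 ?(ltW H0)//.
    apply: le_trans (integral_setT_ge0_le _ _) _.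
      by move=> t; apply: integral_ge0 => x _.
    rewrite /Q/= (@integral_waves (EFin \o p s.1) (EFin \o p s.2) (a s.1) (a s.2))//.
    - rewrite lee_wpmul2l ?lee_fin ?invr_ge0//.
      apply: lee_pmul; [| |exact: gA|exact: gA];
        by apply: integral_ge0 => x _; rewrite lee_fin.
    - by rewrite -subr_eq0 -normr_gt0.
    - by move=> x; rewrite lee_fin.
    - by move=> x; rewrite lee_fin.
  rewrite -!EFinM lee_fin -[leLHS]mulrA ler_wpM2l ?mulr_ge0 ?(ltW H0)//.
  rewrite mulrA ler_piMl ?mulr_ge0// ler_pdivrMr// mul1r; exact: aE.
rewrite sumEFin lee_fin big_split/= lerD//.
  rewrite -mulr_sumr ler_wpM2l ?mulr_ge0 ?(ltW H0)//.
  rewrite -(pair_big xpredT xpredT (fun i j => A i * A j))/=.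
  by under eq_bigr do rewrite -mulr_sumr; rewrite -mulr_suml expr2.
rewrite -(pair_big xpredT xpredT (fun i j => if i == j then 2 * (B i * A i) else 0))/=.
rewrite mulr_sumr; apply: ler_sum => i _.
by rewrite -big_mkcond/= (big_pred1 i)// => j; rewrite eq_sym.
Qed.

End travelling_waves.

(** * L^2 bound for the Fourier transform on the cylinder *)

Section fourier_L2.
Variable R : realType.
Local Notation mu := (@lebesgue_measure R).

Lemma sum_le_esum (M : nat) (nu : 'I_M -> int) (h : int -> \bar R) :
  injective nu -> (forall n, 0 <= h n)%E ->
  (\sum_i h (nu i) <= \esum_(n in setT) h n)%E.
Proof.
move=> nu_inj h0; apply: esum_ge.
exists [set` [seq nu i | i <- enum 'I_M]]; first by split=> //; exact: finite_seq.
rewrite -fsbig_seq; last by rewrite map_inj_uniq// enum_uniq.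
by rewrite big_map big_enum.
Qed.

Lemma L2sq_RTE (f : R -> R -> R[i]) : L2sq_RT f =
  (\int[mu]_x \int[mu]_(y in @torus_dom R) (normsq (f x y))%:E)%E.
Proof.
by apply: eq_integral => x _; apply: eq_integral => y _; rewrite cabs_sqr.
Qed.

Lemma L2sq_RZE (g : R -> int -> R[i]) : L2sq_RZ g =
  (\esum_(n in setT) \int[mu]_xi (normsq (g xi n))%:E)%E.
Proof.
by apply: eq_esum => n _; apply: eq_integral => x _; rewrite cabs_sqr.
Qed.

Variable f : R -> R -> R[i].
Hypothesis mf : cmeasurable [set: R * R] (fun p : R * R => f p.1 p.2).
Hypothesis fL2 : (L2sq_RT f < +oo)%E.

Let D : set (measurableTypeR R) := @torus_dom R.
Let mD : measurable D. Proof. exact: measurable_itv. Qed.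

Let mfx x : cmeasurable D (f x).
Proof.
case: mf => mr mi; split; apply: measurable_funTS.
  exact: (measurableT_comp mr (pair1_measurable x)).
exact: (measurableT_comp mi (pair1_measurable x)).
Qed.

Definition partial_fourier (n : int) (x : R) : R[i] :=
  cintegral D (fun y => expi (- (2 * pi * (n%:~R * y))) * f x y).

Lemma measurable_torus_coef (n : int) (xi : R) : cmeasurable [set: R]
  (fun x => cintegral D (fun y =>
     expi (- (2 * pi * (xi * x + n%:~R * y))) * f x y)).
Proof.
apply: (cmeasurable_cintegral_param mD (g := fun z : R * R =>
  expi (- (2 * pi * (xi * z.1 + n%:~R * z.2))) * f z.1 z.2)).
apply: cmeasurableM mf; apply: cmeasurable_expi.
apply: measurableT_comp => //; apply: measurable_funM => //.
by apply: measurable_funD; apply: measurable_funM.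
Qed.

Lemma measurable_partial_fourier (n : int) : cmeasurable [set: R] (partial_fourier n).
Proof.
have := measurable_torus_coef n 0.
rewrite (_ : (fun x => _) = partial_fourier n)//; apply/funext => x.
by apply: eq_cintegral => y _; rewrite mul0r add0r.
Qed.

(** No x is exceptional: where the slice is not square integrable the right side is infinite. *)
Lemma bessel_partial_fourier (M : nat) (nu : 'I_M -> int) (x : R) :
  injective nu -> ((\sum_i normsq (partial_fourier (nu i) x))%:E <=
    \int[mu]_(y in D) (normsq (f x y))%:E)%E.
Proof.
move=> nu_inj; pose w (i : 'I_M) : R := 2 * pi * (nu i)%:~R.
have oc (k l : 'I_M) : k != l ->
  Rintegral mu D (fun x => cos ((w k - w l) * x)) = 0.
  by move=> kl; case: (@torus_orth R (nu k) (nu l)) => //; rewrite (inj_eq nu_inj).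
have os (k l : 'I_M) : k != l ->
  Rintegral mu D (fun x => sin ((w k - w l) * x)) = 0.
  by move=> kl; case: (@torus_orth R (nu k) (nu l)) => //; rewrite (inj_eq nu_inj).
have := bessel mD (mu_torus_dom R) oc os ltr01 (mfx x).
rewrite mul1e; apply: le_trans; rewrite lee_fin le_eqVlt; apply/orP; left.
apply/eqP; apply: eq_bigr => i _; congr normsq; apply: eq_cintegral => y _.
by rewrite /w mulrA.
Qed.

Let slice_L2 x := (\int[mu]_(y in D) (normsq (f x y))%:E)%E.

Let mslice : measurable_fun [set: measurableTypeR R] slice_L2.
Proof.
pose G (z : R * R) : \bar R := ((fun z => (normsq (f z.1 z.2))%:E) \_ (setT `*` D)) z.
have mG : measurable_fun setT G.
  apply/(measurable_restrictT _ _).1; first exact: measurableX.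
  by apply: measurable_funTS; apply/measurable_EFinP; exact: cmeasurable_normsq mf.
have G0 z : (0 <= G z)%E.
  by apply: erestrict_ge0 => {}z _; rewrite lee_fin normsq_ge0.
have := @measurable_fun_fubini_tonelli_F _ _ _ _ _ mu G mG G0.
rewrite (_ : fubini_F _ _ = slice_L2)//; apply/funext => x.
rewrite /fubini_F /slice_L2 [RHS]integral_mkcond; apply: eq_integral => y _.
rewrite /G !patchE; have -> // : ((x, y) \in [set: R] `*` D) = (y \in D).
by apply/idP/idP; rewrite !inE//= => -[].
Qed.

Let slice_ge0 x : (0 <= slice_L2 x)%E.
Proof. by apply: integral_ge0 => y _; rewrite lee_fin normsq_ge0. Qed.

Let slice_ae : {ae mu, forall x, setT x -> slice_L2 x \is a fin_num}.
Proof.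
apply: integrable_ae => //; apply/integrableP; split => //.
under eq_integral do rewrite gee0_abs//.
by move: fL2; rewrite L2sq_RTE.
Qed.

(* Factoring the character of [x] out of the inner integral is legitimate only
   for almost every [x], those for which [f x] is integrable. *)
Lemma fourier_truncE (K : nat) (xi : R) (n : int) :
  fourier_trunc K f xi n = cfourier (-1) K%:R (partial_fourier n) xi.
Proof.
have mI : measurable (`[- K%:R, K%:R]%classic : set (measurableTypeR R)).
  exact: measurable_itv.
pose P x := cintegral D (fun y => expi (- (2 * pi * (xi * x + n%:~R * y))) * f x y).
pose Q x := expi ((-1)%:~R * (2 * pi * (xi * x))) * partial_fourier n x.
have mP : cmeasurable [set: R] P by exact: measurable_torus_coef.
have mQ : cmeasurable [set: R] Q.
  apply: cmeasurableM (measurable_partial_fourier n).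
  by apply: cmeasurable_expi; do 3 (apply: measurable_funM => //).
have PQ x : slice_L2 x \is a fin_num -> P x = Q x.
  move=> fin.
  have iN : Rintegrable D (fun y => normsq (f x y)).
    apply/integrableP; split.
      by apply/measurable_EFinP; exact: cmeasurable_normsq (mfx x).
    under eq_integral do rewrite /= ger0_norm ?normsq_ge0//.
    by move: fin; rewrite ge0_fin_numE.
  have finD : (mu D < +oo)%E by rewrite mu_torus_dom ltry.
  have iF := cintegrable_L2 mD finD (mfx x) iN.
  rewrite /Q /partial_fourier -cintegralZ//.
    apply: eq_cintegral => y _; rewrite mulrA -expiD; congr (expi _ * _).
    by rewrite mulrN1z; ring.
  have := cintegrableM_expi mD (- (2 * pi * n%:~R)) iF.
  rewrite (_ : (fun x0 => _) = (fun y => expi (- (2 * pi * (n%:~R * y))) * f x y))//.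
  by apply/funext => y; congr (expi _ * _); ring.
rewrite /fourier_trunc /cfourier -/(P _) /cintegral; congr Complex.
  congr fine; apply: ae_eq_integral => //.
  - by apply: measurable_funTS; apply/measurable_EFinP; case: mP.
  - by apply: measurable_funTS; apply/measurable_EFinP; case: mQ.
  case: slice_ae => Z [mZ Z0 subZ]; exists Z; split=> // x /= nPQ.
apply: subZ => /= /(_ Logic.I)/PQ h; apply: nPQ => _.
exact: (congr1 (fun z => (complex.Re z)%:E) h).
congr fine; apply: ae_eq_integral => //.
- by apply: measurable_funTS; apply/measurable_EFinP; case: mP.
- by apply: measurable_funTS; apply/measurable_EFinP; case: mQ.
case: slice_ae => Z [mZ Z0 subZ]; exists Z; split=> // x /= nPQ.
apply: subZ => /= /(_ Logic.I)/PQ h; apply: nPQ => _.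
exact: (congr1 (fun z => (complex.Im z)%:E) h).
Qed.

(** Plancherel's inequality in x for each frequency, then Bessel's inequality in y under the
    integral over x. *)
Lemma sum_fourier_trunc_le (K M : nat) (nu : 'I_M -> int) : (0 < K)%N ->
  injective nu ->
  (\sum_i \int[mu]_xi (normsq (fourier_trunc K f xi (nu i)))%:E <= L2sq_RT f)%E.
Proof.
move=> K0 nu_inj; have K0' : 0 < K%:R :> R by rewrite ltr0n.
pose I : set (measurableTypeR R) := `[- K%:R, K%:R]%classic.
apply: (@le_trans _ _ (\sum_i \int[mu]_(x in I)
    (normsq (partial_fourier (nu i) x))%:E)%E).
  apply: lee_sum => i _.
  under eq_integral do rewrite fourier_truncE.
  by apply: plancherel_le => //; exact: measurable_partial_fourier.
have mI : measurable I by exact: measurable_itv.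
rewrite -ge0_integral_sum//; last 2 first.
- move=> i; apply: measurable_funTS; apply/measurable_EFinP.
  exact: cmeasurable_normsq (measurable_partial_fourier _).
- by move=> i x _; rewrite lee_fin normsq_ge0.
apply: (@le_trans _ _ (\int[mu]_(x in I) slice_L2 x))%E.
  apply: le_integral_ge0 => x _.
    by apply: sume_ge0 => i _; rewrite lee_fin normsq_ge0.
  by rewrite sumEFin; exact: bessel_partial_fourier.
by rewrite L2sq_RTE; exact: integral_setT_ge0_le.
Qed.

Variable fhat : R -> int -> R[i].
Hypothesis mfhat : forall n, cmeasurable [set: R] (fhat^~ n).
Hypothesis hfhat : is_fourier_L2 f fhat.

(** With F_K the truncated transform, [|fhat|^2 <= 2 |F_K|^2 + 2 |F_K - fhat|^2]; the last term
    tends to 0 in L^2 as K grows. The factor 2 is the price of this crude triangle inequality. *)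
Lemma sum_fourier_L2_le (M : nat) (nu : 'I_M -> int) : injective nu ->
  (\sum_i \int[mu]_xi (normsq (fhat xi (nu i)))%:E <= 2%:E * L2sq_RT f)%E.
Proof.
move=> nu_inj.
pose d K := L2sq_RZ (fun xi n => fourier_trunc K f xi n - fhat xi n).
have step K : (0 < K)%N ->
  (\sum_i \int[mu]_xi (normsq (fhat xi (nu i)))%:E <=
   2%:E * L2sq_RT f + 2%:E * d K)%E.
  move=> K0.
  have mt n : cmeasurable [set: R] (fun xi => fourier_trunc K f xi n).
    rewrite (_ : (fun xi => _) = cfourier (-1) K%:R (partial_fourier n)).
      exact: measurable_cfourier (measurable_partial_fourier n).
    by apply/funext => xi; rewrite fourier_truncE.
  have md n : cmeasurable [set: R] (fun xi => fourier_trunc K f xi n - fhat xi n).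
    exact: cmeasurableB (mt n) (mfhat n).
  apply: (@le_trans _ _ (\sum_i (2%:E * \int[mu]_xi
     (normsq (fourier_trunc K f xi (nu i)))%:E + 2%:E * \int[mu]_xi
     (normsq (fourier_trunc K f xi (nu i) - fhat xi (nu i)))%:E))%E).
    apply: lee_sum => i _.
    have m1 : measurable_fun [set: measurableTypeR R]
        (fun xi => (normsq (fourier_trunc K f xi (nu i)))%:E).
      by apply/measurable_EFinP; exact: cmeasurable_normsq (mt _).
    have m2 : measurable_fun [set: measurableTypeR R]
        (fun xi => (normsq (fourier_trunc K f xi (nu i) - fhat xi (nu i)))%:E).
      by apply/measurable_EFinP; exact: cmeasurable_normsq (md _).
    have n0 z : (0 <= (@normsq R z)%:E)%E by rewrite lee_fin normsq_ge0.
    rewrite -!ge0_integralZl// -ge0_integralD//; last 4 first.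
    - by move=> x _; rewrite mule_ge0// lee_fin.
    - exact: measurable_funeM.
    - by move=> x _; rewrite mule_ge0// lee_fin.
    - exact: measurable_funeM.
    apply: le_integral_ge0 => x _ //.
    rewrite -!EFinM -EFinD lee_fin.
    set a := fourier_trunc _ _ _ _; set b := fhat _ _.
    have -> : normsq (a - b) = normsq (b - a).
      by case: a => ? ?; case: b => ? ?; rewrite /normsq/=; ring.
    by have := normsqD_le a (b - a); rewrite addrC subrK.
  rewrite big_split/= -!ge0_sume_distrr//;
    try by move=> i _; apply: integral_ge0 => x _; rewrite lee_fin normsq_ge0.
  apply: leeD; rewrite lee_wpmul2l ?lee_fin//; first exact: sum_fourier_trunc_le.
  rewrite /d L2sq_RZE; apply: (sum_le_esum (h := fun n => \int[mu]_xi
     (normsq (fourier_trunc K f xi n - fhat xi n))%:E)%E) => // n.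
  by apply: integral_ge0 => x _; rewrite lee_fin normsq_ge0.
have Lfin : (2%:E * L2sq_RT f)%E \is a fin_num.
  rewrite fin_numM// ge0_fin_numE// L2sq_RTE.
  by apply: integral_ge0 => x _; exact: slice_ge0.
have cvgr : (2%:E * L2sq_RT f + 2%:E * d K)%E @[K --> \oo] --> (2%:E * L2sq_RT f)%E.
  rewrite -[X in _ --> X]adde0; apply: cvgeD; [|exact: cvg_cst|].
    by rewrite fin_num_adde_defl.
  rewrite -[X in _ --> X](mule0 2%:E); exact: cvgeZl.
rewrite -(cvg_lim (@ereal_hausdorff R) cvgr).
apply: lime_ge; first by apply/cvg_ex; eexists; exact: cvgr.
by exists 1%N => // K /= K0; exact: step.
Qed.

End fourier_L2.

(** * Finitely supported symbols and the size of the cutoff *)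

Section finite_symbol.
Variable R : realType.
Local Notation mu := (@lebesgue_measure R).

(** Passing from K to K + 1 adds only the two end terms of index [-(K+1)] and [K+1], both zero.
    Hence the limit defining [csumZ] is that of an eventually constant sequence. *)
Lemma sum_symmetric_range (K0 K : nat) (h : int -> R) : (K0 <= K)%N ->
  (forall n : int, (K0 < `|n|)%N -> h n = 0) ->
  \sum_(k < (2 * K).+1) h (k%:Z - K%:Z) = \sum_(k < (2 * K0).+1) h (k%:Z - K0%:Z).
Proof.
move=> + h0; elim: K => [|K IH]; first by rewrite leqn0 => /eqP ->.
rewrite leq_eqVlt => /predU1P[->//|KK0].
rewrite -IH//.
have -> : (2 * K.+1)%N = (2 * K).+2 by lia.
rewrite big_ord_recl big_ord_recr/= h0; last by rewrite sub0r abszN.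
rewrite [X in _ + (_ + X)]h0; last first.
  by have -> : (bump 0 (2 * K).+1)%:Z - K.+1%:Z = K.+1%:Z by rewrite /bump/=; lia.
rewrite add0r addr0; apply: eq_bigr => k _; congr h.
by rewrite /bump/= add1n; lia.
Qed.

Lemma csumZ_finite (K0 : nat) (z : int -> R[i]) :
  (forall n : int, (K0 < `|n|)%N -> z n = 0) ->
  csumZ z = \sum_(k < (2 * K0).+1) z (k%:Z - K0%:Z).
Proof.
move=> z0; apply/eqP; rewrite eq_complex Re_sum Im_sum/=; apply/andP; split.
  apply/eqP/lim_near_cst => //; exists K0 => // K /= KK.
  by apply: (@sum_symmetric_range _ _ (fun n => complex.Re (z n))) => // n /z0 ->.
apply/eqP/lim_near_cst => //; exists K0 => // K /= KK.
by apply: (@sum_symmetric_range _ _ (fun n => complex.Im (z n))) => // n /z0 ->.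
Qed.

Lemma cintegral_support (D : set R) (h : R -> R[i]) :
  (forall x, ~ D x -> h x = 0) -> cintegral setT h = cintegral D h.
Proof.
move=> h0; rewrite /cintegral [in RHS]Rintegral_mkcond.
rewrite [X in _ = Complex _ X]Rintegral_mkcond.
congr Complex; apply: eq_Rintegral => x _; rewrite patchE;
  by case: ifPn => //; rewrite notin_setE => /h0 ->.
Qed.

(** The cutoff is not assumed to lie between 0 and 1, so its maximum on [[-2, 2]] enters the final
    constant. *)
Lemma bounded_cutoff (phi : R -> R) : continuous phi ->
  (forall x, 2 <= `|x| -> phi x = 0) ->
  exists2 b, 0 <= b & forall x, phi x ^+ 2 <= b.
Proof.
move=> cphi phi0.
have cphi2 : continuous (fun x => phi x ^+ 2).
  by move=> x; exact: (cvgM (cphi x) (cphi x)).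
have [c _ hc] : exists2 c, c \in `[- 2, 2 : R]%R &
    forall t, t \in `[- 2, 2]%R -> phi t ^+ 2 <= phi c ^+ 2.
  apply: EVT_max; first by lra.
  by apply: continuous_subspaceT => x; exact: cphi2.
exists (phi c ^+ 2) => [|x]; first exact: sqr_ge0.
have [x2|x2] := leP 2 `|x|; first by rewrite phi0// expr0n sqr_ge0.
by apply: hc; rewrite in_itv/= -ler_norml ltW.
Qed.

End finite_symbol.

(** * The solution as a finite sum of travelling waves *)

Section propagator.
Variable R : realType.
Local Notation mu := (@lebesgue_measure R).
Variables (phi : R -> R) (b N : R).
Hypothesis cphi : continuous phi.
Hypothesis phi0 : forall x, 2 <= `|x| -> phi x = 0.
Hypothesis phib : forall x, phi x ^+ 2 <= b.
Hypothesis N1 : 1 <= N.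
Variable fhat : R -> int -> R[i].
Hypothesis mfhat : forall n, cmeasurable [set: R] (fhat^~ n).
Variable alpha : int -> R.
Hypothesis alphaE : forall n,
  (\int[mu]_xi (normsq (fhat xi n))%:E = (alpha n)%:E)%E.

Let N0 : 0 < N. Proof. exact: lt_le_trans N1. Qed.
Let N20 : 0 < 2 * N. Proof. exact: mulr_gt0. Qed.
Let b0 : 0 <= b. Proof. exact: le_trans (sqr_ge0 (phi 0)) (phib 0). Qed.
Let D : set (measurableTypeR R) := `[- (2 * N), 2 * N]%classic.
Let mD : measurable D. Proof. exact: measurable_itv. Qed.
Let finD : (mu D < +oo)%E.
Proof.
by rewrite lebesgue_measure_itv/= lte_fin gtrN// -EFinB ltry.
Qed.

Definition symbol (n : int) (xi : R) : R[i] :=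
  ((phi (xi / N) * phi (n%:~R / N))%:C)%C * fhat xi n.

(** The symbol vanishes outside [[-2N, 2N]], so this truncated integral is its full inverse Fourier
    transform, in a form to which [plancherel_le] applies. *)
Definition profile (n : int) : R -> R[i] := cfourier 1 (2 * N) (symbol n).

Lemma symbol_eq0 n xi : ~ D xi -> symbol n xi = 0.
Proof.
rewrite /D /= in_itv/= -ler_norml => /negP; rewrite -ltNge => h.
rewrite /symbol phi0 ?mul0r// normrM [`|N^-1|]ger0_norm ?invr_ge0 ?(ltW N0)//.
by rewrite ler_pdivlMr// ltW.
Qed.

Lemma measurable_symbol n : cmeasurable [set: R] (symbol n).
Proof.
have mphi : measurable_fun setT (fun xi : R => phi (xi / N) * phi (n%:~R / N)).
  apply: measurable_funM => //.
  by apply: (measurableT_comp (continuous_measurable_fun cphi)); exact: measurable_funM.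
by apply: cmeasurableM (mfhat n); split.
Qed.

Lemma symbol_L2_le n :
  (\int[mu]_(xi in D) (normsq (symbol n xi))%:E <= (b ^+ 2 * alpha n)%:E)%E.
Proof.
rewrite EFinM -alphaE -ge0_integralZl//; last 3 first.
- by apply/measurable_EFinP; exact: cmeasurable_normsq (mfhat n).
- by move=> x _; rewrite lee_fin normsq_ge0.
- by rewrite lee_fin sqr_ge0.
apply: le_trans (integral_setT_ge0_le _ _) _.
  by move=> x; rewrite lee_fin normsq_ge0.
apply: le_integral_ge0 => xi _; first by rewrite lee_fin normsq_ge0.
rewrite -EFinM lee_fin normsqM normsq_real ler_wpM2r ?normsq_ge0//.
by rewrite exprMn [b ^+ 2]expr2 ler_pM ?sqr_ge0.
Qed.

Lemma cintegrable_symbol n : cintegrable D (symbol n).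
Proof.
have [m1 m2] := measurable_symbol n.
have mS : cmeasurable D (symbol n) by split; exact: measurable_funTS.
apply: cintegrable_L2 => //; apply/integrableP; split.
  by apply/measurable_EFinP; exact: cmeasurable_normsq.
under eq_integral do rewrite /= ger0_norm ?normsq_ge0//.
by apply: le_lt_trans (symbol_L2_le n) _; rewrite ltry.
Qed.

Lemma profile_L2_le n :
  (\int[mu]_x (normsq (profile n x))%:E <= (b ^+ 2 * alpha n)%:E)%E.
Proof.
apply: le_trans (symbol_L2_le n).
by apply: plancherel_le => //; exact: measurable_symbol.
Qed.

(** Bernstein's inequality: Bessel with a single character is Cauchy-Schwarz on the frequency
    interval, of length 4N. *)
Lemma profile_le n x : normsq (profile n x) <= 4 * N * (b ^+ 2 * alpha n).
Proof.
have := bessel_cfourier (oner_neq0 _ : (1 : int) != 0) N20 (measurable_symbol n) 1 x.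
rewrite big_ord1 mulr0 addr0 -lee_fin => /le_trans; apply.
rewrite [in leRHS]EFinM (_ : 2 * (2 * N) = 4 * N); last by ring.
by rewrite lee_wpmul2l ?lee_fin ?mulr_ge0 ?(ltW N0)//; exact: symbol_L2_le.
Qed.

Lemma measurable_profile n : cmeasurable [set: R] (profile n).
Proof. exact: measurable_cfourier (measurable_symbol n). Qed.

Let K0 := Num.truncn (2 * N).
Let M := (2 * K0).+1.

(** Enumerates the integers from -K0 to K0, outside which [phi (n / N)] vanishes. *)
Definition freq (i : 'I_M) : int := i%:Z - K0%:Z.

(** The phase [2 pi (xi x + n y) - 4 pi^2 t xi n] equals [2 pi xi (x - 2 pi n t) + 2 pi n y]: on the
    n-th mode the propagator is a translation. *)
Lemma schrod_PNE t x y : schrod_PN phi N fhat t x y =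
  \sum_(i < M) expi (2 * pi * ((freq i)%:~R * y)) *
    profile (freq i) (x - 2 * pi * (freq i)%:~R * t).
Proof.
rewrite /schrod_PN (csumZ_finite (K0 := K0)); last first.
  move=> n nK; have -> : (fun xi : R => expi (2 * pi * (xi * x + n%:~R * y)) *
    expi (- (4 * pi ^+ 2 * t * xi * n%:~R)) *
    ((phi (xi / N) * phi (n%:~R / N))%:C)%C * fhat xi n) = fun=> 0.
    apply/funext => xi; rewrite (phi0 (x := n%:~R / N)).
      by rewrite mulr0 rmorph0 mulr0 mul0r.
    rewrite normrM [`|N^-1|]ger0_norm ?invr_ge0 ?(ltW N0)// ler_pdivlMr//.
    rewrite -intr_norm -abszE.
    apply: le_trans (ltW (truncnS_gt _)) _.
    by rewrite -[leRHS]/(_%:R) ler_nat.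
  by rewrite /cintegral/= !Rintegral_cst// !mul0r.
apply: eq_bigr => i _; rewrite -/(freq i); set n := freq i.
rewrite (cintegral_support (D := D)); last first.
  move=> xi /(symbol_eq0 n) h; by rewrite -mulrA -/(symbol n xi) h mulr0.
pose E (xi : R) := expi (1%:~R * (2 * pi * ((x - 2 * pi * n%:~R * t) * xi))) *
  symbol n xi.
have iE : cintegrable D E.
  have := cintegrableM_expi mD (2 * pi * (x - 2 * pi * n%:~R * t))
    (cintegrable_symbol n).
  rewrite (_ : (fun x0 => _) = E)//.
  by apply/funext => xi; congr (expi _ * _); rewrite mul1r mulrA.
rewrite -[profile _ _]/(cintegral D E) -(cintegralZ mD _ iE).
apply: eq_cintegral => xi _; rewrite /E /symbol !mulrA -!expiD.
by congr (expi _ * _ * _); rewrite mul1r; ring.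
Qed.

(** A unimodular factor [e(-K0 y)] shifts the frequencies to 0, ..., 2 K0, the range used for
    trigonometric polynomials on the torus. *)
Lemma normsq_schrod_PN t x y : normsq (schrod_PN phi N fhat t x y) =
  normsq (\sum_(i < M) profile (freq i) (x - (2 * pi * (freq i)%:~R) * t) *
     expi (2 * pi * (i%:R * y))).
Proof.
rewrite [RHS](_ : _ = normsq (expi (- (2 * pi * (K0%:R * y))) *
  \sum_(i < M) profile (freq i) (x - (2 * pi * (freq i)%:~R) * t) *
     expi (2 * pi * (i%:R * y)))); last by rewrite normsqM normsq_expi mul1r.
rewrite schrod_PNE; congr normsq; rewrite mulr_sumr; apply: eq_bigr => i _.
rewrite [in RHS]mulrCA [RHS]mulrC; congr (_ * _).
rewrite -expiD; congr expi; rewrite /freq intrB.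
by rewrite -[(Posz i)%:~R]/(i%:R) -[(Posz K0)%:~R]/(K0%:R); ring.
Qed.

(** The 8N is the diagonal factor 2 times the 4N of Bernstein's inequality, and [b^4] comes from two
    factors [b^2 alpha]. *)
Lemma L4_schrod_PN_le :
  (\int[mu]_(t in `[0%R, 1%R]%classic) \int[mu]_x \int[mu]_(y in @torus_dom R)
    (cabs (schrod_PN phi N fhat t x y) ^+ 4)%:E <=
   (b ^+ 4 * (4 * harmonic_sum R (2 * M) * (\sum_i alpha (freq i)) ^+ 2
      + 8 * N * \sum_i alpha (freq i) ^+ 2))%:E)%E.
Proof.
under eq_integral => t _ do under eq_integral => x _ do
  under eq_integral => y _ do rewrite cabs_exp4 normsq_schrod_PN.
apply: le_trans (@integral_waves4_le R M (fun i => profile (freq i))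
  (fun i => 2 * pi * (freq i)%:~R) (fun i => b ^+ 2 * alpha (freq i))
  (fun i => 4 * N * (b ^+ 2 * alpha (freq i))) _ _ _ _ _) _ => //.
- by move=> i; exact: measurable_profile.
- move=> i j _; rewrite -mulrBr -intrB.
  have -> : freq i - freq j = i%:Z - j%:Z by rewrite /freq; ring.
  (* The speed gap is [2 pi |i - j|]; only [2 pi >= 1] is used. *)
  rewrite intrB normrM ler_peMl// ger0_norm ?mulr_ge0 ?pi_ge0//.
  by have := pi_ge2 R; lra.
- by move=> i; exact: profile_L2_le.
- by move=> i x; exact: profile_le.
rewrite lee_fin le_eqVlt; apply/orP; left; apply/eqP.
rewrite -mulr_sumr.
have -> : \sum_(i < M) 4 * N * (b ^+ 2 * alpha (freq i)) * (b ^+ 2 * alpha (freq i)) =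
   4 * N * b ^+ 4 * \sum_(i < M) alpha (freq i) ^+ 2.
  by rewrite mulr_sumr; apply: eq_bigr => i _; ring.
ring.
Qed.

Lemma freq_inj : injective freq.
Proof. by move=> i j; rewrite /freq => h; apply: val_inj => /=; lia. Qed.

Lemma freq_count_le : M%:R <= 5 * N.
Proof.
have : K0%:R <= 2 * N by rewrite truncn_le ?(ltW N20).
by rewrite /M -(natr1 (2 * K0)) (natrM _ 2 K0); move: N1; lra.
Qed.

End propagator.

(** * Numerical constants and fourth roots *)

Section constants.
Variable R : realType.

Lemma harmonic_sum_log_le (N : R) (M : nat) : (0 < M)%N -> 1 <= N ->
  M%:R <= 5 * N -> harmonic_sum R (2 * M) <= 10 + ln N.
Proof.
move=> M0 N1 MN; have N0 : 0 < N by apply: lt_le_trans N1.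
have -> : (2 * M = (2 * M).-1.+1)%N by rewrite prednK// muln_gt0.
apply: le_trans (harmonic_sum_le R _) _.
rewrite prednK ?muln_gt0//.
have h1 : ln (2 * M)%:R <= ln (10 * N) :> R.
  rewrite ler_ln ?posrE ?ltr0n ?muln_gt0 ?mulr_gt0//.
  by rewrite natrM; lra.
have h2 : ln (10 * N) = ln 10 + ln N by rewrite lnM ?posrE.
have h3 : ln 10 <= 9 :> R.
  have -> : 10 = 1 + 9 :> R by ring.
  by apply: le_ln1Dx; lra.
by lra.
Qed.

(* When [N < 2] the factor [ln N] may vanish; there are then boundedly many
   frequencies and the l^4 term controls [S ^+ 2]. *)
Lemma log_absorb (N H S Q : R) (M : nat) : 1 <= N -> M%:R <= 5 * N ->
  H <= 10 + ln N -> 0 <= Q -> S ^+ 2 <= M%:R * Q ->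
  4 * H * S ^+ 2 + 8 * N * Q <= 228 * (ln N * S ^+ 2 + N * Q).
Proof.
move=> N1 MN HN Q0 SQ; have N0 : 0 < N by apply: lt_le_trans N1.
have L0 : 0 <= ln N by exact: ln_ge0.
have S0 := sqr_ge0 S.
have NQ0 : 0 <= N * Q by rewrite mulr_ge0// ltW.
have HS : H * S ^+ 2 <= (10 + ln N) * S ^+ 2 by rewrite ler_wpM2r.
have LS0 : 0 <= ln N * S ^+ 2 by rewrite mulr_ge0.
have [N2|N2] := leP 2 N.
  have L2 : 1 / 2 <= ln N.
    have : ln 2 <= ln N by rewrite ler_ln ?posrE.
    have : ln (2^-1) <= - (1 / 2) :> R.
      rewrite [X in ln X](_ : _ = 1 + - (1 / 2)); last by field.
      by apply: le_ln1Dx; lra.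
    by rewrite lnV ?posrE//; lra.
  have : S ^+ 2 <= 2 * (ln N * S ^+ 2).
    by rewrite mulrA ler_peMl//; lra.
  by move: HS; rewrite mulrDl -!mulrA; lra.
have L1 : ln N <= 1.
  have -> : N = 1 + (N - 1) by ring.
  by apply: le_trans (le_ln1Dx _) _; lra.
(* For [N < 2] this and [H <= 11] give [4 * 11 * 5 + 8 = 228], the stated constant; the case
   [N >= 2] needs less. *)
have SQ' : S ^+ 2 <= 5 * (N * Q).
  by apply: le_trans SQ _; rewrite mulrA ler_wpM2r.
have : (10 + ln N) * S ^+ 2 <= 11 * S ^+ 2 by rewrite ler_wpM2r//; lra.
by move: HS; rewrite -!mulrA; lra.
Qed.

Lemma log_absorb_constant : exists2 c : R, 0 <= c &
  forall (N H S Q lam : R) (M : nat), 1 <= N -> M%:R <= 5 * N ->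
  H <= 10 + ln N -> 0 <= Q -> 0 <= S -> S <= 2 * lam -> S ^+ 2 <= M%:R * Q ->
  4 * H * S ^+ 2 + 8 * N * Q <= c * (ln N * lam ^+ 2 + N * Q).
Proof.
(* 912 is 4 times 228, the 4 coming from [S <= 2 * lam] squared. *)
exists 912 => [|N H S Q lam M N1 MN HN Q0 S0 Slam SQ]; first exact: ler0n.
apply: le_trans (log_absorb N1 MN HN Q0 SQ) _.
have lnN0 : 0 <= ln N by exact: ln_ge0.
have S2 : S ^+ 2 <= 4 * lam ^+ 2.
  have -> : 4 * lam ^+ 2 = (2 * lam) ^+ 2 by ring.
  by rewrite ler_sqr ?nnegrE// (le_trans S0).
have lS : ln N * S ^+ 2 <= 4 * (ln N * lam ^+ 2) by rewrite [leRHS]mulrCA ler_wpM2l.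
have NQ : 0 <= N * Q by rewrite mulr_ge0// (le_trans _ N1).
by move: lS NQ; move: (ln N * S ^+ 2) (ln N * lam ^+ 2) (N * Q) => p q r; lra.
Qed.

(** Two crude facts suffice: [X^4 + Y^4 <= (X + Y)^4] for nonnegative X and Y, and [C <= C^4] for
    [C >= 1]. *)
Lemma root4_add_le (C X Y Z : R) : 1 <= C -> 0 <= X -> 0 <= Y ->
  0 <= Z <= C * (X ^+ 4 + Y ^+ 4) -> Z `^ 4^-1 <= C * (X + Y).
Proof.
move=> C1 X0 Y0 /andP[Z0 ZC]; have C0 : 0 <= C by lra.
have XY0 : 0 <= C * (X + Y) by rewrite mulr_ge0// addr_ge0.
have -> : C * (X + Y) = ((C * (X + Y)) ^+ 4) `^ 4^-1.
  by rewrite -powR_mulrn// -powRrM mulfV ?powRr1// pnatr_eq0.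
apply: ge0_ler_powR => //; rewrite ?nnegrE ?exprn_ge0 ?invr_ge0//.
apply: le_trans ZC _; rewrite exprMn; apply: ler_pM => //.
- by rewrite addr_ge0 ?exprn_ge0.
- by rewrite -[leLHS]expr1 ler_weXn2l.
have -> : (X + Y) ^+ 4 = X ^+ 4 + Y ^+ 4 +
  X * Y * (4 * X ^+ 2 + 6 * (X * Y) + 4 * Y ^+ 2) by ring.
rewrite lerDl mulr_ge0 ?mulr_ge0// !addr_ge0 ?mulr_ge0 ?sqr_ge0//.
Qed.

Lemma powR_inv4K (x : R) : 0 <= x -> (x `^ 4^-1) ^+ 4 = x.
Proof.
by move=> x0; rewrite -powR_mulrn ?powR_ge0// -powRrM mulVf ?powRr1// pnatr_eq0.
Qed.

Lemma powR_inv2K (x : R) : 0 <= x -> (x `^ 2^-1) ^+ 2 = x.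
Proof.
by move=> x0; rewrite -powR_mulrn ?powR_ge0// -powRrM mulVf ?powRr1// pnatr_eq0.
Qed.

End constants.

(** * Assembly of the estimate *)

Theorem theorem1p8 (R : realType) (phi : R -> R)
  (phi_smooth : smooth_fun phi)
  (phi_even : forall x, phi (- x) = phi x)
  (phi_one : forall x, `|x| <= 1 -> phi x = 1)
  (phi_zero : forall x, 2 <= `|x| -> phi x = 0) :
  exists C : R, forall (N : R), 1 <= N ->
  forall (f : R -> R -> R[i]) (fhat : R -> int -> R[i]),
    measurable_fun [set: R * R] (fun p : R * R => complex.Re (f p.1 p.2)) ->
    measurable_fun [set: R * R] (fun p : R * R => complex.Im (f p.1 p.2)) ->
    (forall x y, f x (y + 1) = f x y) ->
    (L2sq_RT f < +oo)%E ->
    (forall n : int, measurable_fun [set: R] (fun xi => complex.Re (fhat xi n))) ->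
    (forall n : int, measurable_fun [set: R] (fun xi => complex.Im (fhat xi n))) ->
    is_fourier_L2 f fhat ->
    (L4_time_RT (schrod_PN phi N fhat)
      <= C%:E * ((ln N `^ (4%:R)^-1)%:E * poweR (L2sq_RT f) (2%:R)^-1
                 + (N `^ (4%:R)^-1)%:E * l4L2_RZ fhat))%E.
Proof.
have cphi : continuous phi.
  move=> x; apply: differentiable_continuous; apply/derivable1_diffP.
  exact: (phi_smooth 0%N).
have [b b0 phib] := bounded_cutoff cphi phi_zero.
have [c c0 absorb] := log_absorb_constant R.
(* The added 1 ensures [1 <= C], as [root4_add_le] requires. *)
pose C := 1 + b ^+ 4 * c.
have C1 : 1 <= C by rewrite lerDl mulr_ge0// exprn_ge0.
exists C => N N1 f fhat mfr mfi _ fL2 mhr mhi hf.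
have N0 : 0 < N by apply: lt_le_trans N1.
have mf : cmeasurable [set: R * R] (fun p : R * R => f p.1 p.2) by [].
have mh n : cmeasurable [set: R] (fhat^~ n) by [].
have L0 : (0 <= L2sq_RT f)%E.
  by apply: integral_ge0 => x _; apply: integral_ge0 => y _; rewrite lee_fin sqr_ge0.
have Lfin : L2sq_RT f \is a fin_num by rewrite ge0_fin_numE.
pose lam := fine (L2sq_RT f); have lamE : L2sq_RT f = lam%:E by rewrite fineK.
have lam0 : 0 <= lam by rewrite fine_ge0.
have sum_le M (nu : 'I_M -> int) := @sum_fourier_L2_le R f mf fL2 fhat mh hf M nu.
pose al n := (\int[lebesgue_measure]_xi (normsq (fhat xi n))%:E)%E.
have al0 n : (0 <= al n)%E by apply: integral_ge0 => x _; rewrite lee_fin normsq_ge0.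
have alfin n : al n \is a fin_num.
  rewrite ge0_fin_numE//.
  have := sum_le 1%N (fun=> n); rewrite big_ord1 => /(_ _)/le_lt_trans; apply.
    by move=> i j _; rewrite !ord1.
  by rewrite lamE -EFinM ltry.
pose alpha n := fine (al n).
have alphaE n : al n = (alpha n)%:E by rewrite fineK.
have alpha0 n : 0 <= alpha n by rewrite fine_ge0.
pose M := (2 * Num.truncn (2 * N)).+1.
pose nu : 'I_M -> int := @freq R N.
have nu_inj : injective nu by exact: freq_inj.
have MN : M%:R <= 5 * N by exact: freq_count_le.
pose S := \sum_i alpha (nu i); pose Q := \sum_i alpha (nu i) ^+ 2.
have S0 : 0 <= S by apply: sumr_ge0.
have Q0 : 0 <= Q by apply: sumr_ge0 => i _; exact: sqr_ge0.
have Slam : S <= 2 * lam.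
  rewrite -lee_fin EFinM -lamE -sumEFin.
  by under eq_bigr do rewrite -alphaE; exact: sum_le.
(* Cauchy-Schwarz with unit weights over the M frequencies; this is what controls the L^2 mass when
   [ln N] is close to 0. *)
have SQ : S ^+ 2 <= M%:R * Q.
  have := @sqr_sum_le R 'I_M (index_enum _) xpredT (fun=> 1) (fun i => alpha (nu i)).
  move=> /(_ (fun _ _ => ltr01)) /le_trans; apply.
  rewrite invr1 sumr_const card_ord le_eqVlt; apply/orP; left; apply/eqP.
  by congr (_ * _); apply: eq_bigr => i _; rewrite mul1r.
have HN : harmonic_sum R (2 * M) <= 10 + ln N by exact: harmonic_sum_log_le.
have lnN0 : 0 <= ln N by exact: ln_ge0.
have I4 := L4_schrod_PN_le cphi phi_zero phib N1 mh alphaE.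
rewrite /L4_time_RT; move: I4; set J := (\int[_]_(t in _) _)%E => I4.
have J0 : (0 <= J)%E.
  by apply: integral_ge0 => t _; apply: integral_ge0 => x _;
    apply: integral_ge0 => y _; rewrite lee_fin exprn_ge0// sqrtr_ge0.
have Jfin : J \is a fin_num.
  by rewrite (ge0_fin_numE J0); exact: le_lt_trans I4 (ltry _).
rewrite -(fineK Jfin); have Z0 : 0 <= fine J by rewrite fine_ge0.
move: I4; rewrite -{1}(fineK Jfin) lee_fin => I4.
(* The two terms of the bound, Y with only the frequencies kept by the cutoff; the finite sum Q is
   enlarged to the full l^4 sum at the end. *)
pose X := ln N `^ 4^-1 * lam `^ 2^-1; pose Y := N `^ 4^-1 * Q `^ 4^-1.
have X0 : 0 <= X by rewrite mulr_ge0 ?powR_ge0.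
have Y0 : 0 <= Y by rewrite mulr_ge0 ?powR_ge0.
have X4 : X ^+ 4 = ln N * lam ^+ 2.
  rewrite exprMn powR_inv4K//; congr (_ * _).
  by rewrite -[4%N]/(2 * 2)%N exprM powR_inv2K.
have Y4 : Y ^+ 4 = N * Q by rewrite exprMn !powR_inv4K// ltW.
have ZC : fine J <= C * (X ^+ 4 + Y ^+ 4).
  apply: le_trans I4 _; rewrite X4 Y4.
  have NQ : 0 <= N * Q by rewrite mulr_ge0// ltW.
  have NL : 0 <= ln N * lam ^+ 2 by rewrite mulr_ge0// sqr_ge0.
  apply: (@le_trans _ _ (b ^+ 4 * (c * (ln N * lam ^+ 2 + N * Q)))).
    by rewrite ler_wpM2l ?exprn_ge0//; exact: absorb MN HN Q0 S0 Slam SQ.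
  by rewrite mulrA ler_wpM2r ?addr_ge0// /C lerDr.
have := root4_add_le C1 X0 Y0 (introT andP (conj Z0 ZC)).
rewrite poweR_EFin -lee_fin => /le_trans; apply.
rewrite EFinM; apply: lee_wpmul2l; first by rewrite lee_fin (le_trans ler01).
rewrite [(X + Y)%:E]EFinD lamE; apply: leeD; first by rewrite poweR_EFin -EFinM.
rewrite /Y EFinM; apply: lee_wpmul2l; first by rewrite lee_fin powR_ge0.
rewrite /l4L2_RZ -poweR_EFin.
have sq_ge0 n : (0 <= al n * al n)%E by rewrite mule_ge0.
have esumE : (\esum_(n in setT)
    ((\int[lebesgue_measure]_(xi in setT) ((cabs (fhat xi n)) ^+ 2)%:E) *
     (\int[lebesgue_measure]_(xi in setT) ((cabs (fhat xi n)) ^+ 2)%:E)) =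
   \esum_(n in setT) (al n * al n))%E.
  apply: eq_esum => n _.
  by congr (_ * _)%E; apply: eq_integral => xi _; rewrite cabs_sqr.
rewrite esumE; apply: gt0_ler_poweR.
- by rewrite invr_ge0.
- by rewrite in_itv/= lee_fin Q0 leey.
- by rewrite in_itv/= leey andbT; exact: esum_ge0.
rewrite /Q -sumEFin.
apply: le_trans (sum_le_esum (h := fun n => (al n * al n)%E) nu_inj sq_ge0).
by apply: lee_sum => i _; rewrite !alphaE -EFinM.
Qed.
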